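(* Let $\mathbb{R}^d$ be partitioned into blocks $x=(x^{(1)},\dots,x^{(m)})$ with $x^{(i)}\in\mathbb{R}^{d^{(i)}}$ and $\sum_{i=1}^m d^{(i)}=d$. Let $f:\mathbb{R}^d\to\mathbb{R}$ be $\hat L$-block-wise smooth with respect to this partition, let $r(x)=\sum_{i=1}^m r^{(i)}(x^{(i)})$ where each $r^{(i)}:\mathbb{R}^{d^{(i)}}\to\mathbb{R}\cup\{+\infty\}$ is convex and closed, let $P=f+r$, and suppose $P^\star:=\min_{x}P(x)>-\infty$. Suppose that for some $a\in(0,1)$, $b\in[0,1]$ and $c\ge0$ the delays satisfy $$\tau_k\le\min(k,\;ak^b+c),\qquad\forall k\in\mathbb{N}_0 .$$ Let $\{x_k\}$ be generated by the Async-BCD algorithm (defined in the context) with step-sizes $$\gamma_k=\frac{h}{\hat L\left(a\left(\frac{k+c}{1-a}\right)^b+c+1\right)},\qquad\forall k\in\mathbb{N}_0,$$ where $h\in(0,1)$. Let $\phi(k)=k^{1-b}$ if $b\in[0,1)$ and $\phi(k)=\ln k$ if $b=1$. Then, as $k\to\infty$, $$\min_{t\le k}E\left[\|\tilde\nabla P(x_t)\|^2\right]=O(1/\phi(k)),$$ where $\tilde\nabla P(x)=\hat L\left(\operatorname{prox}_{\frac1{\hat L}r}\left(x-\frac1{\hat L}\nabla f(x)\right)-x\right)$.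
   Context: $\mathbb{N}_0=\{0,1,2,\dots\}$; $\|\cdot\|$ is the Euclidean norm; $E$ denotes expectation over the random block choices of the algorithm. The proximal operator is $\operatorname{prox}_{r}(x)=\arg\min_{y}\{r(y)+\frac12\|y-x\|^2\}$. $\nabla_jf$ is the partial gradient of $f$ with respect to the $j$th block, and $U^{(j)}:\mathbb{R}^{d^{(j)}}\to\mathbb{R}^d$ maps $v$ to the vector whose $j$th block is $v$ and whose other blocks are zero. A differentiable $f$ is $\hat L$-block-wise smooth with respect to the partition if for all $i,j\in\{1,\dots,m\}$, all $x\in\mathbb{R}^d$ and all $v\in\mathbb{R}^{d^{(j)}}$, $$\|\nabla_if(x+U^{(j)}v)-\nabla_if(x)\|\le\hat L\|v\|.$$ Async-BCD (asynchronous block-coordinate descent): starting from an initial iterate $x_0$, at each iteration $k\in\mathbb{N}_0$ one worker updates a single block $j$ of the shared decision vector, $$x_{k+1}^{(j)}=\operatorname{prox}_{\gamma_kr^{(j)}}\left(x_k^{(j)}-\gamma_k\nabla_jf(x_{k-\tau_k})\right),$$ leaving all other blocks unchanged ($x_{k+1}^{(i)}=x_k^{(i)}$ for $i\neq j$). Here $x_{k-\tau_k}$ is the decision vector that this worker read from shared memory and used for its partial gradient, $\tau_k\in\{0,\dots,k\}$ is the delay (the number of updates performed by other workers between the worker's read and write), $\gamma_k\ge 0$ is the step-size, and the block index $j$ was drawn by that worker uniformly at random from $\{1,\dots,m\}$ at time $k-\tau_k$. *)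

(* Defs.v *)
(* MathComp / MathComp-Analysis *)
From HB Require Import structures.
From mathcomp Require Import all_boot all_order all_algebra.
From mathcomp Require Import all_classical all_reals all_analysis.
Import Order.TTheory GRing.Theory Num.Theory.
Import numFieldNormedType.Exports.

Set Implicit Arguments.
Unset Strict Implicit.
Unset Printing Implicit Defensive.

Local Open Scope classical_set_scope.
Local Open Scope ring_scope.

(* The library norm on 'rV[R]_n is the sup norm, hence a separate Euclidean
   norm; the two induce the same topology and the same differentiability. *)
Definition enorm (R : realType) (n : nat) (x : 'rV[R]_n) : R :=
  Num.sqrt (\sum_(i < n) x ord0 i ^+ 2).

Definition gradient (R : realType) (n : nat) (f : 'rV[R]_n -> R)
    (x : 'rV[R]_n) : 'rV[R]_n :=
  \row_(i < n) 'D_(delta_mx ord0 i) f x.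

Definition convex_efun (R : realType) (n : nat) (r : 'rV[R]_n -> \bar R) :=
  forall (x y : 'rV[R]_n) (t : R), 0 <= t <= 1 ->
    (r (t *: x + (1 - t) *: y)%R <= t%:E * r x + (1 - t)%:E * r y)%E.

Definition closed_efun (R : realType) (n : nat) (r : 'rV[R]_n -> \bar R) :=
  closed [set p : 'rV[R]_n * R | (r p.1 <= p.2%:E)%E].

Definition is_minimum (T : Type) (R : realType) (F : T -> \bar R)
    (p : \bar R) :=
  (exists x, F x = p) /\ forall y, (p <= F y)%E.

(* The value 0 is only returned when there is no minimizer, which does not
   happen for a proper closed convex r. *)
Definition prox (R : realType) (n : nat) (r : 'rV[R]_n -> \bar R)
    (x : 'rV[R]_n) : 'rV[R]_n :=
  let obj y := (r y + (2^-1 * enorm (y - x)%R ^+ 2)%:E)%E in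
  xget 0 [set y | forall z, (obj y <= obj z)%E].

(* The space is partitioned into m blocks of sizes d i, and the i-th block of x
   is submxrow x i; block_inj j v has v in block j and 0 elsewhere. *)
Definition block_inj (R : realType) (m : nat) (d : 'I_m -> nat) (j : 'I_m)
    (v : 'rV[R]_(d j)) : 'rV[R]_(\sum_i d i) :=
  \mxrow_i dfwith (fun i => 0 : 'rV[R]_(d i)) j v i.

Definition block_grad (R : realType) (m : nat) (d : 'I_m -> nat)
    (f : 'rV[R]_(\sum_i d i) -> R) (j : 'I_m) (x : 'rV[R]_(\sum_i d i)) :
    'rV[R]_(d j) :=
  submxrow (gradient f x) j.

Definition block_smooth (R : realType) (m : nat) (d : 'I_m -> nat) (L : R)
    (f : 'rV[R]_(\sum_i d i) -> R) :=
  (forall x, differentiable f x) /\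
  forall (i j : 'I_m) (x : 'rV[R]_(\sum_i d i)) (v : 'rV[R]_(d j)),
    enorm (block_grad f i (x + @block_inj R m d j v) - block_grad f i x)
    <= L * enorm v.

Definition separable (R : realType) (m : nat) (d : 'I_m -> nat)
    (r : forall i : 'I_m, 'rV[R]_(d i) -> \bar R)
    (x : 'rV[R]_(\sum_i d i)) : \bar R :=
  (\sum_(i < m) r i (submxrow x i))%E.

Definition prox_grad_map (R : realType) (n : nat) (L : R)
    (f : 'rV[R]_n -> R) (r : 'rV[R]_n -> \bar R) (x : 'rV[R]_n) : 'rV[R]_n :=
  L *: (prox (fun y => ((L^-1)%:E * r y)%E) (x - L^-1 *: gradient f x) - x).

(* One realization of Async-BCD: j k is the block written by update k. *)
Definition async_bcd (R : realType) (m : nat) (d : 'I_m -> nat)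
    (f : 'rV[R]_(\sum_i d i) -> R)
    (r : forall i : 'I_m, 'rV[R]_(d i) -> \bar R)
    (gamma : nat -> R) (tau : nat -> nat) (j : nat -> 'I_m)
    (x : nat -> 'rV[R]_(\sum_i d i)) :=
  forall (k : nat) (i : 'I_m),
    submxrow (x k.+1) i =
    if i == j k
    then prox (fun y => ((gamma k)%:E * r i y)%E)
           (submxrow (x k) i - gamma k *: block_grad f i (x (k - tau k)%N))
    else submxrow (x k) i.

Definition mutually_independent (dd : measure_display)
    (Omega : measurableType dd) (R : realType) (Pr : probability Omega R)
    (T : Type) (J : nat -> Omega -> T) :=
  forall (s : seq nat) (B : nat -> set T), uniq s ->
    (forall k, measurable (J k @^-1` B k)) ->
    Pr (\bigcap_(k in [set` s]) (J k @^-1` B k)) =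
    (\prod_(k <- s) Pr (J k @^-1` B k))%E.

Definition iid_uniform (dd : measure_display)
    (Omega : measurableType dd) (R : realType) (Pr : probability Omega R)
    (m : nat) (J : nat -> Omega -> 'I_m) :=
  [/\ forall k i, measurable (J k @^-1` [set i]),
      forall k i, Pr (J k @^-1` [set i]) = (m%:R^-1)%:E &
      mutually_independent Pr J].

(* The library's big-O at infinity for an extended-real sequence u (for which
   =O_\oo is not available); it forces u to be eventually finite. *)
Definition ebigO (R : realType) (u : nat -> \bar R) (v : nat -> R) :=
  exists2 C : R, 0 < C &
    \forall k \near \oo, (`|u k| <= (C * `|v k|)%:E)%E.

Definition rate (R : realType) (b : R) (k : nat) : R :=
  if b < 1 then k%:R `^ (1 - b) else ln k%:R.

(* Main.v *)
(* Write [D] for the distance between the initial point and a minimizer [xs],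
   measured block by block. The initial point may lie outside the domain of [r],
   so the descent argument is run on an auxiliary trajectory [z] which agrees with
   [x] on the blocks already updated and with [xs] on the others: its objective
   starts at the minimum and so never goes below its initial value. With [U k] the
   event that some block has not been drawn by the read time [k - tau k],
   and the window of [k] the times [t] with [k - tau k <= t < k], the prox inequality
   and the Lipschitz bound on block gradients give, for
   [w t := |z (t+1) - z t|^2 / gamma t] and any [eps > 0],
     P (z (k+1)) - P (z k) <= L/2 (sum of gamma over k and its window) w k
        + L/2 gamma k (sum of w over the window of k) - (1 - eps) w k
        + D^2 / eps * U k / gamma k.
   The step sizes are such that L times the sum of gamma over k and its window,
   and L times the sum of gamma k over all k whose window contains a given t, are
   both at most h, so summing over k bounds the sum of w by a multiple of the sum
   of U k / gamma k. The latter has finite mean, since the probability of U k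
   decays geometrically while 1 / gamma k grows at most linearly. A block residual
   is at most its own virtual prox displacement over gamma k plus a window error;
   averaging over the drawn block bounds the mean of the sum of
   gamma k |residual (x k)|^2, and the sum of gamma grows like the rate. *)
Require Import Defs.
From HB Require Import structures.
From mathcomp Require Import all_boot all_order all_algebra.
From mathcomp Require Import all_classical all_reals all_analysis.
From mathcomp Require Import measurable_realfun ring lra.
Import Order.TTheory GRing.Theory Num.Theory.
Import numFieldNormedType.Exports.

Local Open Scope classical_set_scope.
Local Open Scope ring_scope.

Set Implicit Arguments.
Unset Strict Implicit.
Unset Printing Implicit Defensive.

(** * Inner product and Euclidean norm on row vectors *)

Section Euclidean.
Variables (R : realType) (n : nat).
Implicit Types (x y z : 'rV[R]_n) (a : R).

Definition dot x y : R := \sum_(i < n) x ord0 i * y ord0 i.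

Lemma dotC x y : dot x y = dot y x.
Proof. by apply: eq_bigr => i _; rewrite mulrC. Qed.

Lemma dotDl x y z : dot (x + y) z = dot x z + dot y z.
Proof. by rewrite -big_split; apply: eq_bigr => i _ /=; rewrite mxE mulrDl. Qed.

Lemma dotZl a x y : dot (a *: x) y = a * dot x y.
Proof. by rewrite big_distrr; apply: eq_bigr => i _ /=; rewrite mxE mulrA. Qed.

Lemma dotNl x y : dot (- x) y = - dot x y.
Proof. by rewrite -scaleN1r dotZl mulN1r. Qed.

Lemma dotDr x y z : dot z (x + y) = dot z x + dot z y.
Proof. by rewrite dotC dotDl !(dotC z). Qed.

Lemma dotZr a x y : dot x (a *: y) = a * dot x y.
Proof. by rewrite dotC dotZl dotC. Qed.

Lemma dotNr x y : dot x (- y) = - dot x y.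
Proof. by rewrite dotC dotNl dotC. Qed.

Definition dotE := (dotDl, dotDr, dotNl, dotNr, dotZl, dotZr).

Lemma dot_ge0 x : 0 <= dot x x.
Proof. by apply: sumr_ge0 => i _; rewrite -expr2 sqr_ge0. Qed.

Lemma enorm_sqr x : enorm x ^+ 2 = dot x x.
Proof.
rewrite sqr_sqrtr; last by apply: sumr_ge0 => i _; rewrite sqr_ge0.
by apply: eq_bigr => i _; rewrite expr2.
Qed.

Lemma enorm_ge0 x : 0 <= enorm x.
Proof. exact: sqrtr_ge0. Qed.

Lemma enorm_eq0 x : enorm x = 0 -> x = 0.
Proof.
move=> x0; have /eqP := enorm_sqr x.
rewrite x0 expr0n /= eq_sym (_ : dot x x = \sum_(i < n) x ord0 i ^+ 2); last first.
  by apply: eq_bigr => i _; rewrite expr2.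
rewrite psumr_eq0; last by move=> i _; rewrite sqr_ge0.
by move=> /allP h; apply/rowP => i; have /h := mem_index_enum i; rewrite sqrf_eq0 !mxE => /eqP ->.
Qed.

Lemma enorm0 : enorm (0 : 'rV[R]_n) = 0.
Proof. by rewrite /enorm big1 ?sqrtr0// => i _; rewrite mxE expr0n. Qed.

Lemma enormN x : enorm (- x) = enorm x.
Proof. by rewrite /enorm; congr Num.sqrt; apply: eq_bigr => i _; rewrite mxE sqrrN. Qed.

Lemma enormBC x y : enorm (x - y) = enorm (y - x).
Proof. by rewrite -enormN opprB. Qed.

Lemma enormZ a x : enorm (a *: x) = `|a| * enorm x.
Proof.
rewrite -sqrtr_sqr -sqrtrM ?sqr_ge0//; congr Num.sqrt.
by rewrite big_distrr; apply: eq_bigr => i _ /=; rewrite mxE exprMn.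
Qed.

Lemma dot_le_enorm x y : dot x y <= enorm x * enorm y.
Proof.
have [/enorm_eq0 ->|x0] := eqVneq (enorm x) 0.
  by rewrite enorm0 mul0r /dot big1// => i _; rewrite mxE mul0r.
have [/enorm_eq0 ->|y0] := eqVneq (enorm y) 0.
  by rewrite enorm0 mulr0 /dot big1// => i _; rewrite mxE mulr0.
have xp : 0 < enorm x by rewrite lt_def x0 enorm_ge0.
have yp : 0 < enorm y by rewrite lt_def y0 enorm_ge0.
(* With both norms positive, expanding this square and dividing by [2 * enorm x * enorm y] gives
   Cauchy-Schwarz. *)
have := dot_ge0 (enorm y *: x - enorm x *: y).
rewrite !dotE -!enorm_sqr (dotC y x) => h.
have : 0 < enorm x * enorm y by rewrite mulr_gt0.
by move: h; nra.
Qed.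

Lemma enormD x y : enorm (x + y) <= enorm x + enorm y.
Proof.
rewrite -(@ler_pXn2r _ 2)// ?nnegrE ?addr_ge0 ?enorm_ge0//.
by rewrite enorm_sqr !dotE -!enorm_sqr (dotC y x); have := dot_le_enorm x y; nra.
Qed.

Lemma coord_le_enorm x i : `|x ord0 i| <= enorm x.
Proof.
rewrite -sqrtr_sqr ler_sqrt; last by apply: sumr_ge0 => k _; rewrite sqr_ge0.
by rewrite (bigD1 i)//= lerDl sumr_ge0// => k _; rewrite sqr_ge0.
Qed.

Lemma norm_le_enorm x : `|x| <= enorm x.
Proof.
rewrite /Num.Def.normr /= mx_normrE; apply/bigmax_leP; split=> [|[i j] _ /=].
  exact: enorm_ge0.
by rewrite ord1 coord_le_enorm.
Qed.

Lemma continuous_enorm_sqr x0 : continuous (fun x => enorm (x - x0) ^+ 2).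
Proof.
under eq_fun do rewrite enorm_sqr; move=> x.
have F : Filter (nbhs x) by exact: nbhs_filter.
have hc i : (y - x0) ord0 i @[y --> x] --> (x - x0) ord0 i.
  under eq_fun do rewrite !mxE; rewrite !mxE; apply: cvgB; last exact: cvg_cst.
  exact: coord_continuous.
apply: (cvg_big (F := nbhs x) add_continuous) => i _ /=.
by apply: cvgM.
Qed.

End Euclidean.

(** * Derivatives along lines and the descent inequality *)

Section Descent.
Variables (R : realType) (n : nat).
Implicit Types (f : 'rV[R]_n -> R) (x v : 'rV[R]_n).

Lemma derive_gradient f x v :
  differentiable f x -> 'D_v f x = dot (gradient f x) v.
Proof.
move=> df; rewrite deriveE// {1}(row_sum_delta v) raddf_sum /=.
apply: eq_bigr => i _; rewrite linearZ /= /gradient mxE deriveE//.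
by rewrite mulrC.
Qed.

Lemma is_derive_line f x v (t : R) : differentiable f (x + t *: v) ->
  is_derive t 1 (fun s : R => f (x + s *: v)) (dot (gradient f (x + t *: v)) v).
Proof.
move=> df.
have E : (fun h : R => h^-1 *: (((fun s : R => f (x + s *: v)) \o shift t) (h *: (1 : R))
    - f (x + t *: v))) =
  (fun h : R => h^-1 *: ((f \o shift (x + t *: v)) (h *: v) - f (x + t *: v))).
  apply/funext => h; congr (_ *: (f _ - _)).
  by rewrite /shift /= scalerDl [_ *: (1 : R)]mulr1 addrCA.
apply: DeriveDef.
  by rewrite /derivable E; exact: diff_derivable.
by rewrite /derive E -derive_gradient.
Qed.

(** The mean value theorem on [0, 1], applied to [f] along the segment minus its quadratic model,
    replaces the usual integral of the gradient; the one-sided bound on the ray makes [G']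
    nonpositive there. *)
Lemma descent f L x v : (forall y, differentiable f y) ->
  (forall t : R, 0 <= t ->
     dot (gradient f (x + t *: v) - gradient f x) v <= L * t * enorm v ^+ 2) ->
  f (x + v) <= f x + dot (gradient f x) v + L / 2 * enorm v ^+ 2.
Proof.
move=> df hL; set A := dot (gradient f x) v; set B := enorm v ^+ 2.
pose G (t : R) := f (x + t *: v) - (A * t + L / 2 * B * t ^+ 2).
pose G' (t : R) := dot (gradient f (x + t *: v)) v - (A + L * B * t).
have dG (t : R) : is_derive t 1 G (G' t).
  have dg := is_derive_line (df (x + t *: v)).
  have dq : is_derive t (1 : R) (fun t : R => A * t + L / 2 * B * t ^+ 2) (A + L * B * t).
    apply: is_derive_eq.
    by rewrite /GRing.scale /=; field.
  exact: is_deriveB.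
have cG : {within `[0, 1], continuous G}.
  by apply: derivable_within_continuous => t _; have [] := dG t.
have [t] := MVT ltr01 (fun t _ => dG t) cG.
rewrite in_itv /= => /andP[t0 _].
rewrite /G /G' scale1r scale0r addr0 subr0 mulr1.
have := hL t (ltW t0); rewrite dotDl dotNl -/A -/B => ? ?; nra.
Qed.

End Descent.

(** * Existence, characterization and stability of proximal points *)

Section ProximalOperator.
Variable R : realType.

(** Weierstrass for extended-valued functions with closed sublevel sets: those above the infimum,
    cut by [K], generate a proper filter, and a cluster point in [K] belongs to all of them. An
    infimum [+oo] is treated apart because then no such level exists. *)
Lemma compact_min_lsc (T : topologicalType) (K : set T) (g : T -> \bar R) :
  compact K -> K !=set0 ->
  (forall c : R, closed [set y | (g y <= c%:E)%E]) ->
  exists p, K p /\ forall z, K z -> (g p <= g z)%E.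
Proof.
move=> cK [k0 Kk0] cl.
pose I := ereal_inf (g @` K).
have Ile z : K z -> (I <= g z)%E by move=> Kz; apply: ereal_inf_lbound; exists z.
have [Iy|Iy] := eqVneq I +oo%E.
  by exists k0; split=> // z /Ile; rewrite Iy leye_eq => /eqP ->; rewrite leey.
pose F := filter_from [set c : R | (I < c%:E)%E] (fun c => K `&` [set y | (g y <= c%:E)%E]).
have F_filter : Filter F.
  apply: filter_from_filter => [|c c' Ic Ic'].
    case: I Iy {F Ile} => [i _||] //; last by exists 0; rewrite /= ltNyr.
    by exists (i + 1); rewrite /= lte_fin ltrDl.
  exists (Num.min c c'); first by rewrite /= /Num.min; case: ifP.
  move=> y [Ky /= gy]; split; split=> //=; apply: le_trans gy _;
    by rewrite lee_fin ge_min lexx ?orbT.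
have F_proper : ProperFilter F.
  apply: filter_from_proper => c /= /ereal_inf_lt [_ [y Ky <-] /ltW gy].
  by exists y.
have [p [Kp Fp]] : K `&` cluster F !=set0.
  have [c Ic] : exists c : R, (I < c%:E)%E.
    case: I Iy {F F_filter F_proper Ile} => [i _||] //; last by exists 0; rewrite ltNyr.
    by exists (i + 1); rewrite lte_fin ltrDl.
  by apply: cK; exists c => // y [].
have gp (c : R) : (I < c%:E)%E -> (g p <= c%:E)%E.
  move=> Ic; apply: cl => B Bp; apply: Fp => //.
  by exists c => // y [].
have gpI : (g p <= I)%E.
  case: I Iy gp {F F_filter F_proper Ile Fp} => [i _ gp||] //.
    by apply/lee_addgt0Pr => e e0; apply: gp; rewrite lte_fin ltrDl.
  case: (g p) => [s _ gp||] //; last by move=> _ /(_ 0 (ltNyr _)).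
  by exfalso; have := gp (s - 1) (ltNyr _); rewrite lee_fin leNgt ltrBlDr ltrDl ltr01.
by exists p; split=> // z Kz; apply: le_trans gpI (Ile _ Kz).
Qed.

Variable n : nat.
Implicit Types (r : 'rV[R]_n -> \bar R) (x y p : 'rV[R]_n).

Lemma compact_eball x0 (M : R) : compact [set y : 'rV[R]_n | enorm (y - x0) <= M].
Proof.
apply: bounded_closed_compact.
  exists (M + enorm x0); split; first exact: num_real.
  move=> N MN y /= yM; apply: le_trans (norm_le_enorm _) _.
  rewrite -(subrK x0 y); apply: le_trans (enormD _ _) _; lra.
have [M0|M0] := ltP M 0.
  rewrite (_ : [set _ | _] = set0); first exact: closed0.
  apply/seteqP; split=> y //= yM; have := enorm_ge0 (y - x0); lra.
rewrite (_ : [set _ | _] = (fun y => enorm (y - x0) ^+ 2) @^-1` [set s | s <= M ^+ 2]).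
  apply: closed_comp; last exact: closed_le.
  by move=> y _; exact: continuous_enorm_sqr.
by apply/seteqP; split=> y /=; rewrite ler_pXn2r ?nnegrE ?enorm_ge0.
Qed.

Lemma closed_efun_sublevel r (q : 'rV[R]_n -> R) : closed_efun r -> continuous q ->
  closed [set y | (r y <= (q y)%:E)%E].
Proof.
move=> cl cq.
rewrite (_ : [set _ | _] = (fun y => (y, q y)) @^-1` [set p | (r p.1 <= p.2%:E)%E])//.
apply: closed_comp cl => y _.
apply: (@cvg_pair _ _ _ (nbhs y) (nbhs y) (nbhs (q y)) _ _ _ (fun y => y) q); first exact: cvg_id.
exact: cq.
Qed.

Definition prox_objective r x y : \bar R := (r y + (2^-1 * enorm (y - x) ^+ 2)%:E)%E.

Section Existence.
Variables (r : 'rV[R]_n -> \bar R).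
Hypotheses (r_ninfty : forall y, r y != -oo%E) (r_convex : convex_efun r)
  (r_closed : closed_efun r).
Variables (y0 : 'rV[R]_n) (rho0 : R).
Hypothesis (ry0 : r y0 = rho0%:E).

(* A bound below on a ball propagates to linear growth by convexity. *)
Lemma convex_linear_lower_bound : exists M : R, 0 <= M /\
  forall y, ((- (M * (1 + enorm (y - y0))))%:E <= r y)%E.
Proof.
have [|c|p [_ rp]] := @compact_min_lsc _ _ r (@compact_eball y0 1).
- by exists y0; rewrite /= subrr enorm0.
- by apply: (closed_efun_sublevel (q := fun=> c)) => //; exact: cst_continuous.
have {}rp y : enorm (y - y0) <= 1 -> (r p <= r y)%E by exact: rp.
case E : (r p) (rp y0) => [s||] => rs; last by have := r_ninfty p; rewrite E.
  2: by have := rs; rewrite subrr enorm0 ry0 => /(_ ler01).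
exists (`|s| + `|rho0|); split=> [|y]; first by rewrite addr_ge0.
set N := enorm (y - y0); have N0 : 0 <= N by exact: enorm_ge0.
have [N1|N1] := leP N 1.
  apply: le_trans (rp _ N1); rewrite E lee_fin.
  have := mulr_ge0 (normr_ge0 rho0) N0; have := mulr_ge0 (normr_ge0 s) N0.
  by have := normr_ge0 rho0; have := ler_norm (- s); rewrite normrN; lra.
have NN : 0 < N by lra.
pose u := N^-1 *: y + (1 - N^-1) *: y0.
have uy0 : u - y0 = N^-1 *: (y - y0).
  by rewrite /u scalerBl scale1r scalerBr -addrA [X in _ + X]addrAC subrr add0r.
have un : enorm (u - y0) <= 1.
  by rewrite uy0 enormZ -/N ger0_norm ?invr_ge0// mulVf// gt_eqF.
have := le_trans (rp _ un) (@r_convex y y0 N^-1 _).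
rewrite E ry0 invr_ge0 N0 invf_le1// (ltW N1) => /(_ isT).
case Ey : (r y) => [t||]; last by have := r_ninfty y; rewrite Ey.
  2: by rewrite leey.
rewrite -!EFinM -EFinD !lee_fin => h.
have {}h : s * N <= t + (N - 1) * rho0.
  have := ler_wpM2r N0 h; rewrite mulrDl mulrAC mulVf ?gt_eqF// mul1r.
  by rewrite mulrAC mulrBl mul1r mulVf ?gt_eqF.
have : - s * N <= `|s| * N by rewrite ler_wpM2r// -normrN ler_norm.
have : (N - 1) * rho0 <= (N - 1) * `|rho0| by rewrite ler_wpM2l ?ler_norm ?subr_ge0 ?ltW.
by have := normr_ge0 s; have := normr_ge0 rho0; lra.
Qed.

(** Beyond a large radius the quadratic term beats the linear lower bound on [r], so [y0] is no
    worse there; on the remaining ball a minimizer exists by compactness. *)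
Lemma prox_exists x :
  exists p, forall z, (prox_objective r x p <= prox_objective r x z)%E.
Proof.
have [M [M0 hM]] := convex_linear_lower_bound.
have qc : continuous (fun y => 2^-1 * enorm (y - x) ^+ 2 : R).
  move=> y; apply: (@continuousM _ _ (fun=> 2^-1) (fun y => enorm (y - x) ^+ 2) y).
    exact: cst_continuous.
  exact: continuous_enorm_sqr.
pose E := enorm (y0 - x).
pose A := 2^-1 * E ^+ 2 + rho0.
(* For [N = enorm (z - x) > B] one has [N / 2 - M > 1] and [N > |A + M (1 + E)|], hence
   [N (N / 2 - M) >= A + M (1 + E)]. *)
pose B := 2 * M + 2 + `|A + M * (1 + E)|.
have E0 : 0 <= E := enorm_ge0 _.
have far z : B < enorm (z - x) -> (prox_objective r x y0 <= prox_objective r x z)%E.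
  move=> zB; rewrite /prox_objective ry0 -EFinD.
  apply: (@le_trans _ _ (- (M * (1 + enorm (z - y0))) + 2^-1 * enorm (z - x) ^+ 2)%:E); last first.
    by rewrite EFinD leeD2r.
  rewrite lee_fin.
  have : enorm (z - y0) <= enorm (z - x) + E.
    by rewrite -(subrKA x) /E (enormBC y0) enormD.
  rewrite -/E => /(ler_wpM2l M0) h.
  have := ler_norm (A + M * (1 + E)); have := normr_ge0 (A + M * (1 + E)).
  move: zB; rewrite /B; set N := `|_| => zB N0 hN.
  have : A + M * (1 + E) <= enorm (z - x) * (2^-1 * enorm (z - x) - M) by nra.
  by rewrite /A; lra.
have [|c|p [Kp hp]] := @compact_min_lsc _ _ (prox_objective r x) (@compact_eball x (Num.max B E)).
- by exists y0; rewrite /= -/E le_max lexx orbT.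
- have qc' : continuous (fun y => c - 2^-1 * enorm (y - x) ^+ 2).
    move=> y; apply: (@continuousB _ _ _ (fun=> c) (fun y => 2^-1 * enorm (y - x) ^+ 2) y).
      exact: cst_continuous.
    exact: qc.
  rewrite (_ : [set _ | _] = [set y | (r y <= (c - 2^-1 * enorm (y - x) ^+ 2)%:E)%E]).
    exact: (closed_efun_sublevel r_closed qc').
  by apply/seteqP; split=> y /=; rewrite EFinB leeBrDr.
exists p => z; have [zB|zB] := leP (enorm (z - x)) B.
  by apply: hp; rewrite /= le_max zB.
by apply: le_trans (far _ zB); apply: hp; rewrite /= le_max lexx orbT.
Qed.

Lemma prox_minimizes x z : (prox_objective r x (prox r x) <= prox_objective r x z)%E.
Proof.
have [p hp] := prox_exists x; rewrite /prox.
by case: xgetP => [_ _ /(_ z)//|/(_ p) /= []].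
Qed.

End Existence.

(** The variational inequality of the prox: for [gam > 0], [(x - p) / gam] is a subgradient of [r]
    at [p], written without division and with finiteness of [r p] built in. *)
Definition prox_point (gam : R) r x p := exists2 rho : R, r p = rho%:E &
  forall y (s : R), r y = s%:E -> gam * rho + dot (x - p) (y - p) <= gam * s.

(** Moving from [p] a fraction [t] towards [y] changes the quadratic by a first-order term plus
    [O(t^2)], and convexity controls [r]; small [t] leaves the first-order condition. *)
Lemma minimizer_prox_point r x p y0 (rho0 : R) :
  (forall y, r y != -oo%E) -> convex_efun r -> r y0 = rho0%:E ->
  (forall z, (prox_objective r x p <= prox_objective r x z)%E) ->
  prox_point 1 r x p.
Proof.
move=> rN cvx ry0 pmin; rewrite /prox_point.
case E : (r p) => [rho||]; last by have := rN p; rewrite E.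
  2: by have := pmin y0; rewrite /prox_objective E ry0.
exists rho => // y s rys; rewrite !mul1r.
set q := enorm (y - p) ^+ 2; have q0 : 0 <= q by rewrite sqr_ge0.
have key (t : R) : 0 < t <= 1 -> rho + dot (x - p) (y - p) - s <= t * q.
  move=> /andP[t0 t1].
  have := @cvx y p t; rewrite (ltW t0) t1 E rys => /(_ isT).
  have := pmin (t *: y + (1 - t) *: p); rewrite /prox_objective E.
  case: (r _) => [u||//]; last by rewrite -!EFinM -EFinD.
  have -> : t *: y + (1 - t) *: p - x = (p - x) + t *: (y - p).
    by apply/rowP => i; rewrite !mxE; ring.
  rewrite -!EFinM -!EFinD !lee_fin /q !enorm_sqr -(opprB p x) !dotE.
  move=> h1 h2; rewrite -(ler_pM2l t0).
  have := dot_ge0 (y - p); rewrite !dotE; move: h1 h2.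
  rewrite (dotC y p) (dotC y x) (dotC x p); nra.
rewrite -subr_le0 leNgt; apply/negP; set A := _ - s => A0.
have D : 0 < A + q + 1 by lra.
(* This [t] lies in (0, 1] and gives [t * q < A], contradicting [key]. *)
have := key (A / (A + q + 1)); rewrite divr_gt0// ler_pdivrMr// mul1r.
have -> : A <= A + q + 1 by lra.
move=> /(_ isT); rewrite -/A mulrAC ler_pdivlMr//; nra.
Qed.

Lemma prox_pointP gam r x y0 (rho0 : R) : 0 < gam ->
  (forall y, r y != -oo%E) -> convex_efun r -> closed_efun r -> r y0 = rho0%:E ->
  prox_point gam r x (prox (fun y => (gam%:E * r y)%E) x).
Proof.
move=> g0 rN cvx cl ry0.
pose r' y := (gam%:E * r y)%E.
have r'N y : r' y != -oo%E.
  by rewrite /r'; case: (r y) (rN y) => [//||//] _; rewrite gt0_muley.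
have cvx' : convex_efun r'.
  move=> u v t t01; have /andP[t0 t1] := t01.
  rewrite /r' (muleCA t%:E) (muleCA (1 - t)%:E) -muleDr//; last first.
    have aux (s : R) w : 0 <= s -> (s%:E * r w != -oo)%E.
      rewrite le_eqVlt => /predU1P[<-|s0]; first by rewrite mul0e.
      by case: (r w) (rN w) => [//|_|//]; rewrite gt0_muley.
    by rewrite /adde_def !negb_and (aux t)// (aux (1 - t))// ?subr_ge0// orbT.
  by rewrite lee_pmul2l//; apply: cvx.
have cl' : closed_efun r'.
  rewrite /closed_efun (_ : [set _ | _] = (fun p : 'rV[R]_n * R => (p.1, gam^-1 * p.2)) @^-1`
      [set p | (r p.1 <= p.2%:E)%E]).
    apply: closed_comp cl => p _.
    apply: (@cvg_pair _ _ _ (nbhs p) (nbhs p.1) (nbhs (gam^-1 * p.2))); first exact: cvg_fst.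
    by apply: cvgMr; exact: cvg_snd.
  by apply/seteqP; split=> -[y t] /=; rewrite EFinM lee_pdivlMl.
have r'y0 : r' y0 = (gam * rho0)%:E by rewrite /r' ry0.
have [rho e h] := minimizer_prox_point r'N cvx' r'y0 (prox_minimizes r'N cvx' cl' r'y0 x).
move: e; rewrite /r'; set p := prox _ x in h *.
case E : (r p) (rN p) => [s||//]; last by rewrite gt0_muley.
move=> _ [e]; exists s => // y u ru.
by have := h y (gam * u); rewrite /r' ru mul1r -e mul1r; apply.
Qed.

(** The variational inequality makes [p] better than any [z] by [enorm (z - p) ^+ 2 / 2], so the
    minimizer is unique and the choice made by [prox] must be [p]. *)
Lemma prox_eq gam r x p : 0 < gam -> (forall y, r y != -oo%E) ->
  prox_point gam r x p -> prox (fun y => (gam%:E * r y)%E) x = p.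
Proof.
move=> g0 rN [rho rp h].
have key z : (gam%:E * r p + (2^-1 * enorm (p - x) ^+ 2 + 2^-1 * enorm (z - p) ^+ 2)%:E <=
    gam%:E * r z + (2^-1 * enorm (z - x) ^+ 2)%:E)%E.
  case E : (r z) (rN z) => [s||//]; last by rewrite gt0_muley// addye// leey.
  rewrite rp -!EFinM -!EFinD lee_fin => _; have := h z s E.
  have -> : z - x = (z - p) - (x - p) by apply/rowP => i; rewrite !mxE; ring.
  rewrite -(opprB x p); move: (z - p) (x - p) => B A.
  rewrite enormN !enorm_sqr !dotE (dotC B A); lra.
have sq0 z : 0 <= 2^-1 * enorm (z - p) ^+ 2 by rewrite mulr_ge0 ?sqr_ge0// invr_ge0.
rewrite /prox; case: xgetP => [q _ /= /(_ p)|/(_ p) /= []].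
  have := key q; rewrite rp; case: (r q) (rN q) => [s||//] _; last by rewrite gt0_muley.
  rewrite -!EFinM -!EFinD !lee_fin => h1 h2.
  have : enorm (q - p) ^+ 2 = 0 by apply/eqP; rewrite eq_le sqr_ge0 andbT; lra.
  by move/eqP; rewrite sqrf_eq0 => /eqP/enorm_eq0/eqP; rewrite subr_eq0 => /eqP.
move=> z; apply: le_trans (key z); rewrite rp leeD2l// lee_fin.
by rewrite lerDl.
Qed.

(** Testing each variational inequality at the other point and adding gives firm nonexpansiveness;
    Cauchy-Schwarz then removes the square. *)
Lemma prox_point_nonexpansive gam r x x' p p' : 
  prox_point gam r x p -> prox_point gam r x' p' -> enorm (p - p') <= enorm (x - x').
Proof.
move=> [rho rp h] [rho' rp' h'].
have := h _ _ rp'; have := h' _ _ rp => h1 h2.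
have h3 : enorm (p - p') ^+ 2 <= dot (x - x') (p - p').
  rewrite enorm_sqr; move: h1 h2.
  have -> : x' - p' = (x - p) - (x - x') + (p - p') by apply/rowP => i; rewrite !mxE; ring.
  rewrite -(opprB p p'); move: (x - p) (x - x') (p - p') => A B C.
  by rewrite !dotE; lra.
have := le_trans h3 (dot_le_enorm _ _); have := enorm_ge0 (p - p').
by rewrite le_eqVlt => /predU1P[<-|p0]; rewrite ?enorm_ge0// expr2 ler_pM2r.
Qed.

(** Each variational inequality is tested at the other point and multiplied by the other step
    length, so that the values of [r] cancel. This compares the displacement per unit step for two
    step lengths. *)
Lemma prox_point_step_mono gam lam r x g p q : 0 < gam <= lam ->
  prox_point gam r (x - gam *: g) p -> prox_point lam r (x - lam *: g) q ->
  gam * enorm (q - x) <= lam * enorm (p - x).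
Proof.
move=> /andP[g0 gl] [rho rp h] [rho' rq h'].
have l0 : 0 < lam by exact: lt_le_trans gl.
have := h _ _ rq; have := h' _ _ rp.
have -> : x - lam *: g - q = - (q - x) - lam *: g by apply/rowP => i; rewrite !mxE; ring.
have -> : x - gam *: g - p = - (p - x) - gam *: g by apply/rowP => i; rewrite !mxE; ring.
have -> : p - q = (p - x) - (q - x) by apply/rowP => i; rewrite !mxE; ring.
have -> : q - p = (q - x) - (p - x) by apply/rowP => i; rewrite !mxE; ring.
move: (p - x) (q - x) => P Q; rewrite !dotE -!enorm_sqr (dotC Q P) => h1 h2.
have h3 : gam * enorm Q ^+ 2 + lam * enorm P ^+ 2 <= (gam + lam) * dot P Q.
  have := ler_wpM2l (ltW g0) h1; have := ler_wpM2l (ltW l0) h2; lra.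
have h4 : gam * enorm Q ^+ 2 + lam * enorm P ^+ 2 <= (gam + lam) * (enorm P * enorm Q).
  by apply: le_trans h3 _; rewrite ler_pM2l ?dot_le_enorm// addr_gt0.
have := enorm_ge0 P; have := enorm_ge0 Q; move: h4.
move: (enorm P) (enorm Q) => a b h5 b0 a0.
rewrite leNgt; apply/negP => lt1.
(* [h5] factors into this product; if [gam * b > lam * a] held, then [b > a] as well since
   [gam <= lam], and both factors would be positive. *)
have : (gam * b - lam * a) * (b - a) <= 0 by lra.
rewrite leNgt => /negP; apply; rewrite mulr_gt0//; first lra.
rewrite subr_gt0 -(ltr_pM2l g0); apply: le_lt_trans lt1.
by rewrite ler_wpM2r.
Qed.

(** The auxiliary point [p'] has step [lam] but gradient [g]: from [p] to [p'] only the step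
    changes, from [p'] to [q] only the gradient, so monotonicity and nonexpansiveness apply
    separately. *)
Lemma prox_point_residual gam lam r x g g' p q : 0 < gam <= lam ->
  (exists p', prox_point lam r (x - lam *: g) p') ->
  prox_point gam r (x - gam *: g) p -> prox_point lam r (x - lam *: g') q ->
  lam^-1 * enorm (q - x) <= gam^-1 * enorm (p - x) + enorm (g' - g).
Proof.
move=> gl [p' hp'] hp hq; have /andP[g0 gl'] := gl.
have l0 : 0 < lam by exact: lt_le_trans gl'.
have := prox_point_step_mono gl hp hp'; have := prox_point_nonexpansive hq hp'.
have -> : x - lam *: g' - (x - lam *: g) = - (lam *: (g' - g)).
  by apply/rowP => i; rewrite !mxE; ring.
rewrite enormN enormZ gtr0_norm// => h1 h2.
have h3 : enorm (q - x) <= enorm (q - p') + enorm (p' - x).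
  by rewrite -(subrKA p' q); exact: enormD.
have h4 : lam^-1 * enorm (p' - x) <= gam^-1 * enorm (p - x).
  by rewrite ler_pdivrMl// mulrCA ler_pdivlMl.
apply: le_trans (_ : lam^-1 * (lam * enorm (g' - g) + enorm (p' - x)) <= _).
  by rewrite ler_pM2l ?invr_gt0//; lra.
by rewrite mulrDr mulKf ?gt_eqF//; lra.
Qed.

End ProximalOperator.

(** * Block decomposition of vectors, gradients and prox *)

Section Blocks.
Variables (R : realType) (m : nat) (d : 'I_m -> nat).
Local Notation V := 'rV[R]_(\sum_i d i).
Implicit Types (x y z : V) (f : V -> R).

Lemma dot_blocks x y : dot x y = \sum_i dot (submxrow x i) (submxrow y i).
Proof.
have E n (u v : 'rV[R]_n) : dot u v = (u *m v^T) ord0 ord0.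
  by rewrite mxE; apply: eq_bigr => i _; rewrite mxE.
rewrite E -{1}(submxrowK x) -{1}(submxrowK y) tr_mxrow mul_mxrow_mxcol summxE.
by apply: eq_bigr => i _; rewrite E.
Qed.

Lemma enorm_sqr_blocks x : enorm x ^+ 2 = \sum_i enorm (submxrow x i) ^+ 2.
Proof. by rewrite enorm_sqr dot_blocks; apply: eq_bigr => i _; rewrite enorm_sqr. Qed.

Lemma submxrowZ c x i : submxrow (c *: x) i = c *: submxrow x i.
Proof. by apply/matrixP => a b; rewrite !mxE. Qed.

Lemma submxrow_block_inj i j (v : 'rV[R]_(d j)) :
  submxrow (block_inj v) i = dfwith (fun i => 0 : 'rV[R]_(d i)) j v i.
Proof. exact: mxrowK. Qed.

Lemma block_inj_in j (v : 'rV[R]_(d j)) : submxrow (block_inj v) j = v.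
Proof. by rewrite submxrow_block_inj dfwithin. Qed.

Lemma block_inj_out i j (v : 'rV[R]_(d j)) :
  i != j -> submxrow (block_inj v) i = 0.
Proof. by move=> ij; rewrite submxrow_block_inj dfwithout// eq_sym. Qed.

Lemma block_injZ c j (v : 'rV[R]_(d j)) : c *: block_inj v = block_inj (c *: v).
Proof.
apply/mxrowP => i; rewrite submxrowZ.
have [->|ij] := eqVneq i j; first by rewrite !block_inj_in.
by rewrite !block_inj_out// scaler0.
Qed.

Lemma dot_block_inj x j (v : 'rV[R]_(d j)) : dot x (block_inj v) = dot (submxrow x j) v.
Proof.
rewrite dot_blocks (bigD1 j)//= block_inj_in big1 ?addr0// => i ij.
by rewrite block_inj_out// /dot big1// => k _; rewrite [X in _ * X]mxE mulr0.
Qed.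

Lemma enorm_block_inj j (v : 'rV[R]_(d j)) : enorm (block_inj v) = enorm v.
Proof.
apply/eqP; rewrite -(@eqrXn2 _ 2)// ?enorm_ge0// !enorm_sqr.
by rewrite dot_block_inj block_inj_in.
Qed.

Lemma block_update z z' j : (forall i, i != j -> submxrow z' i = submxrow z i) ->
  z' = z + block_inj (submxrow z' j - submxrow z j).
Proof.
move=> h; apply/mxrowP => i; rewrite submxrowD.
have [->|ij] := eqVneq i j; first by rewrite block_inj_in addrC subrK.
by rewrite block_inj_out// addr0 h.
Qed.

Lemma sum_block_inj x : x = \sum_j block_inj (submxrow x j).
Proof.
apply/mxrowP => i; rewrite submxrow_sum (bigD1 i)//= block_inj_in big1 ?addr0// => j ji.
by rewrite block_inj_out// eq_sym.
Qed.

Section Smooth.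
Variables (L : R) (f : V -> R).
Hypothesis smooth : block_smooth L f.

Lemma block_descent x j (v : 'rV[R]_(d j)) :
  f (x + block_inj v) <= f x + dot (block_grad f j x) v + L / 2 * enorm v ^+ 2.
Proof.
have [df hL] := smooth.
have h (t : R) : 0 <= t -> dot (gradient f (x + t *: block_inj v) - gradient f x)
    (block_inj v) <= L * t * enorm (block_inj v) ^+ 2.
  move=> t0; rewrite dot_block_inj submxrowB; apply: le_trans (dot_le_enorm _ _) _.
  rewrite enorm_block_inj expr2 mulrA ler_wpM2r ?enorm_ge0//.
  have := hL j j x (t *: v); rewrite enormZ ger0_norm// block_injZ mulrA.
  exact.
by have := descent df h; rewrite dot_block_inj enorm_block_inj.
Qed.

(** Passing from [x] to [z] one block at a time uses the block-wise bound once per block. *)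
Lemma block_grad_lipschitz i x z : enorm (block_grad f i z - block_grad f i x) <=
  L * \sum_j enorm (submxrow z j - submxrow x j).
Proof.
have [_ hL] := smooth.
have E : z = x + \sum_j block_inj (submxrow (z - x) j).
  by rewrite -sum_block_inj addrC subrK.
have -> : \sum_j enorm (submxrow z j - submxrow x j) = \sum_j enorm (submxrow (z - x) j).
  by apply: eq_bigr => j _; rewrite submxrowB.
rewrite {1}E {E}; move: (z - x) => v.
(* The predicate quantifies over every base point, so that the bounds for two successive
   displacements add up. *)
pose K (y : V) (a : R) := forall x, enorm (block_grad f i (x + y) - block_grad f i x) <= L * a.
suff : K (\sum_j block_inj (submxrow v j)) (\sum_j enorm (submxrow v j)) by exact.
apply: (big_ind2 K) => [{}x|y a y' a' Ky Ky' {}x|j _ {}x]; last exact: hL.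
  by rewrite addr0 subrr enorm0 mulr0.
rewrite addrA -(subrKA (block_grad f i (x + y))) mulrDr [leRHS]addrC.
by apply: le_trans (enormD _ _) _; rewrite lerD.
Qed.

End Smooth.

Section Separable.
Variable r : forall i : 'I_m, 'rV[R]_(d i) -> \bar R.
Arguments r : clear implicits.
Hypothesis r_ninfty : forall i (y : 'rV[R]_(d i)), r i y != -oo%E.

Lemma separable_ninfty y : separable r y != -oo%E.
Proof.
rewrite /separable; elim/big_rec: _ => // i s _ sN.
by rewrite adde_eq_ninfty negb_or r_ninfty.
Qed.

Lemma separable_sum y (rho : 'I_m -> R) : (forall i, r i (submxrow y i) = (rho i)%:E) ->
  separable r y = (\sum_i rho i)%:E.
Proof. by move=> h; rewrite /separable -sumEFin; apply: eq_bigr => i _; rewrite h. Qed.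

(** Without [-oo] no cancellation occurs, so one infinite term would make the whole sum [+oo]. *)
Lemma separable_fin y (s : R) : separable r y = s%:E ->
  exists2 rho : 'I_m -> R, (forall i, r i (submxrow y i) = (rho i)%:E) & s = \sum_i rho i.
Proof.
move=> sy; have fin i : r i (submxrow y i) \is a fin_num.
  rewrite fin_numE r_ninfty /=; apply/negP => /eqP ri.
  have : separable r y = +oo%E.
    rewrite /separable (bigD1 i)//= ri addye//.
    by elim/big_rec: _ => // k t _ tN; rewrite adde_eq_ninfty negb_or r_ninfty.
  by rewrite sy.
exists (fun i => fine (r i (submxrow y i))) => [i|]; first by rewrite fineK.
apply: EFin_inj; rewrite -sy; apply: separable_sum => i; by rewrite fineK.
Qed.

(** The block inequalities sum to the variational inequality of the concatenated point, and
    [prox_eq] identifies that point with the prox. *)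
Lemma prox_separable gam x i : 0 < gam -> (forall i, convex_efun (r i)) ->
  (forall i, closed_efun (r i)) ->
  (forall i, exists (y : 'rV[R]_(d i)) (rho : R), r i y = rho%:E) ->
  submxrow (prox (fun y => (gam%:E * separable r y)%E) x) i =
  prox (fun y : 'rV[R]_(d i) => (gam%:E * r i y)%E) (submxrow x i).
Proof.
move=> g0 cvx cl proper.
pose p k := prox (fun y : 'rV[R]_(d k) => (gam%:E * r k y)%E) (submxrow x k).
suff -> : prox (fun y => (gam%:E * separable r y)%E) x = \mxrow_k p k by rewrite mxrowK.
apply: prox_eq => //; first exact: separable_ninfty.
have hp k : prox_point gam (r k) (submxrow x k) (p k).
  by have [y [rho ry]] := proper k; apply: prox_pointP ry.
have [rho hrho] : {rho : 'I_m -> R | forall k, r k (p k) = (rho k)%:E}.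
  exists (fun k => fine (r k (p k))) => k.
  by have [s -> _] := hp k.
exists (\sum_k rho k).
  by apply: separable_sum => k; rewrite mxrowK.
move=> y s /separable_fin [sg ry ->].
rewrite dot_blocks !big_distrr /= -big_split /=; apply: ler_sum => k _.
have [rk e /(_ _ _ (ry k))] := hp k.
by rewrite !submxrowB mxrowK; move: e; rewrite hrho => -[->].
Qed.

End Separable.
End Blocks.

(** * Delays, step sizes and summability *)

Section StepSizes.
Variables (R : realType) (L a b c h : R) (tau : nat -> nat) (gamma : nat -> R).
Hypotheses (L_gt0 : 0 < L) (a01 : 0 < a < 1) (b01 : 0 <= b <= 1) (c_ge0 : 0 <= c)
  (tau_le : forall k, (tau k <= k)%N /\ (tau k)%:R <= a * k%:R `^ b + c)
  (h01 : 0 < h < 1)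
  (gammaE : forall k,
    gamma k = h / (L * (a * ((k%:R + c) / (1 - a)) `^ b + c + 1))).

(* An upper bound for the delay of every update whose gradient was read no later
   than time [k]: if update [l] reads at [l - tau l <= k], then [tau l <= a l + c]
   gives [l <= (k + c) / (1 - a)]. *)
Definition span (k : nat) : R := a * ((k%:R + c) / (1 - a)) `^ b + c.

Lemma base_ge0 (k : nat) : 0 <= (k%:R + c) / (1 - a).
Proof.
by have /andP[_ a1] := a01; rewrite divr_ge0 ?subr_ge0 ?(ltW a1)// addr_ge0.
Qed.

Lemma span_ge0 k : 0 <= span k.
Proof. by have /andP[/ltW a0 _] := a01; rewrite addr_ge0// mulr_ge0// powR_ge0. Qed.

Lemma base_le (k : nat) : (k%:R + c) / (1 - a) <= (1 + c) / (1 - a) * k.+1%:R.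
Proof.
have /andP[_ a1] := a01.
rewrite mulrAC ler_pM2r ?invr_gt0 ?subr_gt0// -natr1.
by have := mulr_ge0 c_ge0 (ler0n R k); lra.
Qed.

Lemma gamma_span k : L * gamma k * (span k + 1) = h.
Proof.
rewrite gammaE -/(span k); have := span_ge0 k => s0.
by field; rewrite gt_eqF ?andbT/= ?gt_eqF//; lra.
Qed.

Lemma gamma_gt0 k : 0 < gamma k.
Proof.
have /andP[h0 _] := h01; rewrite gammaE divr_gt0// mulr_gt0//.
by rewrite ltr_wpDl ?ltr01//; exact: span_ge0.
Qed.

Lemma gamma_le k : L * gamma k <= h.
Proof.
rewrite -[leRHS](gamma_span k) ler_peMr//; first by rewrite mulr_ge0// ltW// gamma_gt0.
by rewrite lerDr span_ge0.
Qed.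

Lemma gamma_le1 k : L * gamma k <= 1.
Proof. by have /andP[_ /ltW h1] := h01; exact: le_trans (gamma_le k) h1. Qed.

Lemma span_mono k l : (k <= l)%N -> span k <= span l.
Proof.
move=> kl; have /andP[a0 a1] := a01; have /andP[b0 _] := b01.
rewrite lerD2r ler_pM2l// ge0_ler_powR// ?nnegrE ?base_ge0//.
by rewrite ler_pM2r ?invr_gt0 ?subr_gt0// lerD2r ler_nat.
Qed.

Lemma gamma_anti k l : (k <= l)%N -> gamma l <= gamma k.
Proof.
move=> /span_mono kl; have e := gamma_span k; have e' := gamma_span l.
have := span_ge0 k; have := gamma_gt0 l; have := gamma_gt0 k => g0 g0' s0.
rewrite -(ler_pM2l L_gt0) -(@ler_pM2r _ (span k + 1)); last by lra.
rewrite e -e' ler_pM2l ?mulr_gt0//; lra.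
Qed.

Lemma read_time k t : (k - tau k <= t)%N -> k%:R <= (t%:R + c) / (1 - a).
Proof.
have /andP[a0 a1] := a01; have /andP[b0 b1] := b01; have [tk tkb] := tau_le k.
(* The case [k = 0] is separate: for [b = 0] the power k^b is 1 there, so it is not bounded by
   [k]. *)
case: k tk tkb => [|k] tk tkb kt; first exact: base_ge0.
rewrite ler_pdivlMr ?subr_gt0//.
have k1 : k.+1%:R `^ b <= k.+1%:R :> R.
  by rewrite -[leRHS]powRr1 ?ler0n// ler_powR// ler1n.
have : (k.+1%:R : R) <= t%:R + (tau k.+1)%:R by rewrite -natrD ler_nat addnC -leq_subLR.
have := ler_wpM2l (ltW a0) k1; lra.
Qed.

Lemma delay_le_span k t : (k - tau k <= t)%N -> (tau k)%:R <= span t.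
Proof.
move=> kt; have /andP[a0 _] := a01; have /andP[b0 _] := b01; have [_ tkb] := tau_le k.
apply: le_trans tkb _; rewrite lerD2r ler_pM2l// ge0_ler_powR ?nnegrE ?ler0n ?base_ge0//.
exact: read_time.
Qed.

(** Each step in the window is at most the one at the read time [s = k - tau k], there are
    [tau k + 1 <= span s + 1] of them, and [gamma_span] at [s] closes the bound. *)
Lemma window_steps k : L * (\sum_(k - tau k <= t < k.+1) gamma t) <= h.
Proof.
have [tk _] := tau_le k.
apply: (@le_trans _ _ (L * (\sum_(k - tau k <= t < k.+1) gamma (k - tau k)%N))).
  rewrite ler_pM2l//; apply: ler_sum_nat => t /andP[kt _].
  exact: gamma_anti.
rewrite sumr_const_nat -(gamma_span (k - tau k)) -mulrA ler_pM2l// -mulr_natr.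
rewrite ler_pM2l ?gamma_gt0// subSn ?leq_subr// subKn// -natr1 lerD2r.
exact: delay_le_span.
Qed.

(** After exchanging the sums, a given [t] meets only windows of [k] with [t < k <= t + span t], and
    each such [gamma k] is at most [gamma t]; [gamma_span] at [t] then bounds its total weight. *)
Lemma window_exchange K (v : nat -> R) : (forall t, 0 <= v t) ->
  L * (\sum_(0 <= k < K) gamma k * \sum_(k - tau k <= t < k) v t) <= h * \sum_(0 <= t < K) v t.
Proof.
move=> v0; pose P k t := ((k - tau k <= t) && (t < k))%N.
have -> : \sum_(0 <= k < K) gamma k * (\sum_(k - tau k <= t < k) v t) =
    \sum_(0 <= t < K) \sum_(0 <= k < K | P k t) gamma k * v t.
  transitivity (\sum_(0 <= k < K) \sum_(0 <= t < K | P k t) gamma k * v t).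
    apply: eq_big_nat => k /andP[_ kK]; rewrite big_distrr /=.
    by rewrite (big_nat_widenl _ 0)// (big_nat_widen _ _ K) 1?ltnW.
  by rewrite (exchange_big_dep_nat predT).
rewrite !big_distrr /=; apply: ler_sum => t _.
rewrite -big_distrl /= mulrA ler_wpM2r//.
pose N := Num.trunc (span t).
have cnt : (count (P^~ t) (index_iota 0 K) <= N)%N.
  rewrite -size_filter.
  apply: (@leq_trans (size (index_iota t.+1 (t + N).+1))); last first.
    by rewrite size_iota subSS addKn.
  apply: uniq_leq_size; first by rewrite filter_uniq// iota_uniq.
  move=> k; rewrite mem_filter !mem_index_iota => /andP[/andP[kt tk] _].
  rewrite tk ltnS /= -leq_subLR truncn_ge_nat ?span_ge0//.
  apply: le_trans (delay_le_span kt); rewrite ler_nat.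
  by rewrite leq_subCl.
have /andP[h0 _] := h01.
apply: (@le_trans _ _ (L * (\sum_(0 <= k < K | P k t) gamma t))).
  by rewrite ler_pM2l//; apply: ler_sum => k /andP[_ /ltnW]; exact: gamma_anti.
rewrite -big_filter big_const_seq count_predT size_filter iter_addr_0 -mulr_natr mulrA.
rewrite -(gamma_span t) ler_pM2l ?mulr_gt0 ?gamma_gt0//.
apply: (@le_trans _ _ N%:R); first by rewrite ler_nat.
by rewrite ler_wpDr// truncn_le span_ge0.
Qed.

(** Equals [span 1 + 1], the constant with which [span k + 1] is compared to a power of [k + 1]. *)
Definition growth : R := a * ((1 + c) / (1 - a)) `^ b + c + 1.

Lemma growth_ge1 : 1 <= growth.
Proof.
have /andP[a0 a1] := a01.
by rewrite lerDr addr_ge0// mulr_ge0 ?powR_ge0// ltW.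
Qed.

Lemma span_le k : span k + 1 <= growth * k.+1%:R `^ b.
Proof.
have /andP[a0 a1] := a01; have /andP[b0 b1] := b01.
have B0 : 0 <= (1 + c) / (1 - a) by rewrite divr_ge0 ?subr_ge0 ?(ltW a1)// addr_ge0.
have k1 : 1 <= k.+1%:R `^ b :> R.
  by rewrite -[leLHS](powRr0 k.+1%:R) ler_powR// ler1n.
have : ((k%:R + c) / (1 - a)) `^ b <= ((1 + c) / (1 - a)) `^ b * k.+1%:R `^ b.
  rewrite -powRM ?ler0n// ge0_ler_powR ?nnegrE ?base_ge0//; last exact: base_le.
  exact: mulr_ge0.
move=> /(ler_wpM2l (ltW a0)); have := ler_wpM2l c_ge0 k1; rewrite /growth /span; lra.
Qed.

Lemma gamma_ge k : h / (L * growth) * k.+1%:R `^ (- b) <= gamma k.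
Proof.
have /andP[h0 _] := h01; have g1 := growth_ge1; have g0 : 0 < growth by lra.
have kb : 0 < k.+1%:R `^ b :> R by rewrite powR_gt0.
have s1 : 0 < span k + 1 by have := span_ge0 k; lra.
rewrite powRN gammaE -/(span k) -mulrA -invfM -mulrA ler_pM2l// lef_pV2 ?posrE ?mulr_gt0//.
by rewrite ler_pM2l// span_le.
Qed.

Lemma gammaV_le k : (gamma k)^-1 <= L * growth / h * k.+1%:R.
Proof.
have /andP[h0 _] := h01; have g1 := growth_ge1; have g0 : 0 < growth by lra.
have /andP[b0 b1] := b01.
rewrite gammaE invf_div -/(span k) [leRHS]mulrAC ler_pM2r ?invr_gt0// -[leRHS]mulrA ler_pM2l//.
apply: le_trans (span_le k) _; rewrite ler_pM2l//.
by rewrite -[leRHS]powRr1 ?ler0n// ler_powR// ler1n.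
Qed.

(** [read_time] taken at the read time itself shows that read times grow at least linearly; this
    turns decay in [k - tau k] into decay in [k]. *)
Lemma lag_le k : k.+1%:R <= ((1 + c) / (1 - a) + 1) * (k - tau k).+1%:R.
Proof.
have /andP[a0 a1] := a01.
have := read_time (leqnn (k - tau k)); set t := (k - tau k)%N => kt.
rewrite -natr1 mulrDl mul1r lerD// ?ler1n//; apply: le_trans kt _.
exact: base_le.
Qed.

Lemma sum_gamma_ge k : (0 < k)%N ->
  h / (L * growth) * rate b k <= \sum_(0 <= t < k.+1) gamma t.
Proof.
move=> k0; have /andP[h0 _] := h01; have g0 : 0 < growth by have := growth_ge1; lra.
have /andP[b0 b1] := b01.
apply: (@le_trans _ _ (\sum_(0 <= t < k.+1) h / (L * growth) * t.+1%:R `^ (- b))); last first.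
  by apply: ler_sum => t _; exact: gamma_ge.
rewrite -big_distrr /= ler_pM2l; last by rewrite divr_gt0// mulr_gt0.
(* For [b < 1] each of the [k + 1] terms is at least the last one; for [b = 1] the harmonic sum is
   compared with [ln] through [ln (1 + x) <= x]. *)
rewrite /rate; case: ltP => [b1'|b1'].
  apply: (@le_trans _ _ (\sum_(0 <= t < k.+1) k.+1%:R `^ (- b))); last first.
    apply: ler_sum_nat => t /andP[_ tk].
    rewrite !powRN lef_pV2 ?posrE ?powR_gt0// ge0_ler_powR ?nnegrE//.
    by rewrite ler_nat.
  have -> : \sum_(0 <= t < k.+1) k.+1%:R `^ (- b) = k.+1%:R `^ (1 - b) :> R.
    rewrite sumr_const_nat subn0 powRD ?pnatr_eq0 ?implybT//.
    by rewrite powRr1 ?mulr_natl.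
  by rewrite ge0_ler_powR ?nnegrE ?subr_ge0// ler_nat.
have -> : b = 1 by apply/eqP; rewrite eq_le b1 b1'.
have ln_sum n : ln n.+1%:R <= \sum_(0 <= t < n) t.+1%:R `^ (- 1) :> R.
  elim: n => [|n IH]; first by rewrite ln1 big_geq.
  rewrite big_nat_recr//= powRN powRr1//.
  have -> : n.+2%:R = n.+1%:R * (1 + n.+1%:R^-1) :> R.
    by rewrite mulrDr mulfV ?pnatr_eq0// mulr1 natr1.
  rewrite lnM ?posrE ?addr_gt0// lerD// le_ln1Dx//.
  by apply: (@lt_le_trans _ _ 0); rewrite ?ltrN10.
apply: le_trans (ln_sum k.+1); rewrite ler_ln ?posrE ?ltr0n// ler_nat.
by rewrite ltnW.
Qed.

(** Bernoulli gives [u / 7 * (n + 1) <= (1 + u / 7) ^+ n], and 7 is large enough that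
    [(1 - u) * (1 + u / 7) ^+ 3 <= 1]. The cube absorbs the linear growth of [1 / gamma] and leaves
    the summable [1 / (k + 1) ^+ 2]. *)
Lemma geometric_cubic_decay (u : R) (n : nat) : 0 < u <= 1 ->
  (1 - u) ^+ n * (u / 7 * n.+1%:R) ^+ 3 <= 1.
Proof.
move=> /andP[u0 u1].
have bernoulli : 1 + n%:R * (u / 7) <= (1 + u / 7) ^+ n.
  elim: n => [|n IH]; first by rewrite mul0r addr0 expr0.
  rewrite exprS -natr1.
  have := mulr_ge0 (ler0n R n) (sqr_ge0 (u / 7)).
  have : 0 <= 1 + u / 7 by lra.
  move=> /ler_wpM2l/(_ _ _ IH); lra.
apply: (@le_trans _ _ ((1 - u) ^+ n * ((1 + u / 7) ^+ n) ^+ 3)).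
  rewrite ler_wpM2l ?exprn_ge0 ?subr_ge0// ler_pXn2r ?nnegrE ?exprn_ge0//.
  - by apply: le_trans bernoulli; rewrite -[n.+1%:R]natr1; lra.
  - by rewrite mulr_ge0//; lra.
  - lra.
rewrite -exprM mulnC exprM -exprMn exprn_ile1//.
  by rewrite mulr_ge0 ?exprn_ge0 ?subr_ge0//; lra.
nra.
Qed.

Lemma sum_inv_sqr_le2 K : \sum_(0 <= k < K) (k.+1%:R ^+ 2)^-1 <= 2 :> R.
Proof.
suff H n : \sum_(0 <= k < n.+1) (k.+1%:R ^+ 2)^-1 <= 2 - n.+1%:R^-1 :> R.
  case: K => [|K]; first by rewrite big_geq.
  by apply: le_trans (H K) _; rewrite gerBl invr_ge0.
elim: n => [|n IH]; first by rewrite big_nat1 expr1n invr1; lra.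
rewrite big_nat_recr//=; apply: le_trans (lerD IH (lexx _)) _.
rewrite -[n.+2%:R]natr1.
set x : R := n.+1%:R; have x0 : 0 < x by rewrite ltr0n.
rewrite -subr_ge0.
have -> : 2 - (x + 1)^-1 - (2 - x^-1 + ((x + 1) ^+ 2)^-1) = (x * (x + 1) ^+ 2)^-1.
  by field; rewrite !gt_eqF//; lra.
by rewrite invr_ge0 mulr_ge0 ?sqr_ge0// ltW.
Qed.

(** Cubic decay in [k - tau k] transfers to [k] by [lag_le]; division by [gamma k] costs a factor
    linear in [k], and the result is still summable. *)
Lemma sum_geometric_lag (u : R) : 0 < u <= 1 -> exists C : R, forall K,
  \sum_(0 <= k < K) (1 - u) ^+ (k - tau k) * (gamma k)^-1 <= C.
Proof.
move=> u01; have /andP[u0 u1] := u01; have /andP[h0 _] := h01; have /andP[_ a1] := a01.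
have g0 : 0 < growth by have := growth_ge1; lra.
set B := (1 + c) / (1 - a) + 1.
have B0 : 0 < B by rewrite ltr_wpDl// divr_ge0 ?subr_ge0 ?(ltW a1)// addr_ge0.
set G := L * growth / h; have G0 : 0 < G by rewrite divr_gt0// mulr_gt0.
set dl := u / 7; have dl0 : 0 < dl by rewrite divr_gt0.
exists (G * B ^+ 3 / dl ^+ 3 * 2) => K.
apply: (@le_trans _ _ (\sum_(0 <= k < K) G * B ^+ 3 / dl ^+ 3 * (k.+1%:R ^+ 2)^-1)).
  apply: ler_sum => k _; set n := (k - tau k)%N.
  have kn : k.+1%:R <= B * n.+1%:R by exact: lag_le.
  have k0 : 0 < k.+1%:R :> R by rewrite ltr0n.
  have p0 : 0 <= (1 - u) ^+ n by rewrite exprn_ge0// subr_ge0.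
  apply: le_trans (ler_wpM2l p0 (gammaV_le k)) _.
  have := geometric_cubic_decay n u01; rewrite -/dl => dec.
  have dec' : (1 - u) ^+ n * k.+1%:R ^+ 3 <= B ^+ 3 / dl ^+ 3.
    rewrite ler_pdivlMr ?exprn_gt0//.
    apply: (@le_trans _ _ (B ^+ 3 * ((1 - u) ^+ n * (dl * n.+1%:R) ^+ 3))); last first.
      by rewrite ler_piMr// exprn_ge0// ltW.
    have : k.+1%:R ^+ 3 <= (B * n.+1%:R) ^+ 3 by rewrite ler_pXn2r ?nnegrE// mulr_ge0// ltW.
    move=> /(ler_wpM2l p0)/(ler_wpM2r (exprn_ge0 3 (ltW dl0))) /le_trans; apply.
    by rewrite !exprMn -!mulrA; lra.
  rewrite -/G mulrCA -2![leRHS]mulrA ler_pM2l// [leRHS]mulrA ler_pdivlMr ?exprn_gt0//.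
  by rewrite -mulrA -exprS.
rewrite -big_distrr /= ler_wpM2l ?sum_inv_sqr_le2//.
by rewrite !mulr_ge0 ?invr_ge0 ?exprn_ge0// ltW.
Qed.

End StepSizes.

(** * Estimates along one realization of the draws *)

Section Pathwise.
Variables (R : realType) (m : nat) (d : 'I_m -> nat).
Local Notation V := 'rV[R]_(\sum_i d i).
Variables (L h : R) (f : V -> R) (r : forall i : 'I_m, 'rV[R]_(d i) -> \bar R).
Arguments r : clear implicits.
Variables (tau : nat -> nat) (gamma : nat -> R) (xs : V).
Hypotheses (L_gt0 : 0 < L) (smooth : block_smooth L f)
  (r_ninfty : forall i (y : 'rV[R]_(d i)), r i y != -oo%E)
  (r_convex : forall i, convex_efun (r i)) (r_closed : forall i, closed_efun (r i)).
Hypotheses (xs_fin : separable r xs \is a fin_num)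
  (xs_min : forall y, ((f xs)%:E + separable r xs <= (f y)%:E + separable r y)%E).
Hypotheses (h01 : 0 < h < 1) (gamma_gt0 : forall k, 0 < gamma k)
  (gamma_le1 : forall k, L * gamma k <= 1)
  (window_steps : forall k, L * (\sum_(k - tau k <= t < k.+1) gamma t) <= h)
  (window_exchange : forall K (v : nat -> R), (forall t, 0 <= v t) ->
    L * (\sum_(0 <= k < K) gamma k * \sum_(k - tau k <= t < k) v t) <=
    h * \sum_(0 <= t < K) v t).

Lemma r_proper i : exists (y : 'rV[R]_(d i)) (rho : R), r i y = rho%:E.
Proof.
have [rho hrho _] := separable_fin r_ninfty (esym (fineK xs_fin)).
by exists (submxrow xs i), (rho i).
Qed.

(** Taken for every block, drawn or not: the virtual displacements of all blocks are what the
    average over a uniform draw sees. *)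
Definition step (x : nat -> V) (k : nat) (i : 'I_m) : 'rV[R]_(d i) :=
  prox (fun y : 'rV[R]_(d i) => ((gamma k)%:E * r i y)%E)
    (submxrow (x k) i - gamma k *: block_grad f i (x (k - tau k)%N)).

Definition increment (x : nat -> V) (j : nat -> 'I_m) (k : nat) : R :=
  enorm (submxrow (x k.+1) (j k) - submxrow (x k) (j k)).

(** Majorizes the squared block residual by the virtual displacement over [gamma k] and a window
    error. Along a run, only draws before [k] enter, so it can be averaged over the draw at [k]. *)
Definition residual_bound (x : nat -> V) (j : nat -> 'I_m) (k : nat) (i : 'I_m) : R :=
  2 * (enorm (step x k i - submxrow (x k) i) / gamma k) ^+ 2 +
  2 * (L * h * \sum_(k - tau k <= t < k) increment x j t ^+ 2 / gamma t).

Lemma residual_bound_ge0 x j k i : 0 <= residual_bound x j k i.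
Proof.
have /andP[/ltW h0 _] := h01; apply: addr_ge0; apply: mulr_ge0 => //; first exact: sqr_ge0.
apply: mulr_ge0; first by rewrite mulr_ge0// ltW.
by apply: sumr_ge0 => t _; rewrite divr_ge0 ?sqr_ge0// ltW.
Qed.

Definition drawn (j : nat -> 'I_m) (k : nat) (i : 'I_m) : bool := [exists t : 'I_k, j t == i].

Definition pending (j : nat -> 'I_m) (k : nat) : bool := ~~ [forall i, drawn j k i].

Lemma drawnS j k i : drawn j k.+1 i = drawn j k i || (j k == i).
Proof.
apply/existsP/orP => [[[t tk] /= jt]|[/existsP[t jt]|jk]].
- move: tk; rewrite ltnS leq_eqVlt => /predU1P[tk|tk]; first by right; rewrite -tk.
  by left; apply/existsP; exists (Ordinal tk).
- by exists (widen_ord (leqnSn k) t).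
- by exists ord_max.
Qed.

Lemma drawn_mono j k l i : (k <= l)%N -> drawn j k i -> drawn j l i.
Proof.
by move=> kl /existsP[t jt]; apply/existsP; exists (widen_ord kl t).
Qed.

Lemma pending_anti j k l : (k <= l)%N -> pending j l -> pending j k.
Proof.
move=> kl; apply: contra => /forallP dk; apply/forallP => i.
exact: drawn_mono (dk i).
Qed.

Lemma block_prox_point gam i (y : 'rV[R]_(d i)) : 0 < gam ->
  prox_point gam (r i) y (prox (fun y : 'rV[R]_(d i) => (gam%:E * r i y)%E) y).
Proof. by move=> g0; have [y0 [rho ry]] := r_proper i; apply: prox_pointP ry. Qed.

Lemma step_prox_point x k i : prox_point (gamma k) (r i)
  (submxrow (x k) i - gamma k *: block_grad f i (x (k - tau k)%N)) (step x k i).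
Proof. exact: block_prox_point. Qed.

(** Stated for any sequence that changes one block per update, since it serves both [x] and the
    auxiliary [z]. *)
Lemma block_grad_window (y : nat -> V) (j : nat -> 'I_m) i s k :
  (forall k i, i != j k -> submxrow (y k.+1) i = submxrow (y k) i) -> (s <= k)%N ->
  enorm (block_grad f i (y k) - block_grad f i (y s)) <=
  L * \sum_(s <= t < k) increment y j t.
Proof.
move=> hy; have [_ hL] := smooth.
elim: k => [|k IH]; first by rewrite leqn0 => /eqP ->; rewrite big_geq// subrr enorm0 mulr0.
rewrite leq_eqVlt => /predU1P[->|]; first by rewrite big_geq// subrr enorm0 mulr0.
rewrite ltnS => sk; rewrite big_nat_recr//= mulrDr [leRHS]addrC.
rewrite -(subrKA (block_grad f i (y k))).
apply: le_trans (enormD _ _) _; apply: lerD; last exact: IH.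
by rewrite {1}(block_update (hy k)).
Qed.

Lemma weighted_cauchy_schwarz s k (e : nat -> R) :
  L * (\sum_(s <= t < k) gamma t) <= h ->
  L * (\sum_(s <= t < k) e t) ^+ 2 <= h * \sum_(s <= t < k) e t ^+ 2 / gamma t.
Proof.
have /andP[h0 _] := h01.
set S := \sum_(s <= t < k) e t; set W := \sum_(s <= t < k) e t ^+ 2 / gamma t => G.
(* Expanding the sum of [gamma t * (e t / gamma t - mu) ^+ 2] bounds [W] below by [2 mu S] minus
   [mu ^+ 2] times the sum of [gamma]; with this [mu] and [G] that is at least [L * S ^+ 2 / h]. *)
pose mu := L * S / h.
have : 2 * mu * S <= W + mu ^+ 2 * \sum_(s <= t < k) gamma t.
  rewrite /S /W !big_distrr -big_split /=; apply: ler_sum => t _.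
  have g0 := gamma_gt0 t; have := mulr_ge0 (ltW g0) (sqr_ge0 (e t / gamma t - mu)).
  have -> : gamma t * (e t / gamma t - mu) ^+ 2 =
     e t ^+ 2 / gamma t - 2 * mu * e t + mu ^+ 2 * gamma t by field; rewrite gt_eqF.
  lra.
have := ler_wpM2l (mulr_ge0 (ltW L_gt0) (sqr_ge0 (S / h))) G.
have -> : 2 * mu * S = 2 * (L * S ^+ 2 / h) by rewrite /mu; field; rewrite gt_eqF.
have -> : L * (S / h) ^+ 2 * h = L * S ^+ 2 / h by field; rewrite gt_eqF.
have -> : L * (S / h) ^+ 2 * (L * \sum_(s <= t < k) gamma t) =
  mu ^+ 2 * \sum_(s <= t < k) gamma t by rewrite /mu; field; rewrite gt_eqF.
by move=> h1 h2; rewrite [leRHS]mulrC -ler_pdivrMr//; lra.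
Qed.

Lemma window_steps_past k : L * (\sum_(k - tau k <= t < k) gamma t) <= h.
Proof.
apply: le_trans (window_steps k); rewrite ler_pM2l// [leRHS]big_nat_recr ?leq_subr//=.
by rewrite lerDl ltW.
Qed.

(** * One run compared with its auxiliary trajectory *)

Section Trajectory.
Variables (x : nat -> V) (j : nat -> 'I_m).
Hypothesis (run : async_bcd f r gamma tau j x).

Lemma x_in k : submxrow (x k.+1) (j k) = step x k (j k).
Proof. by rewrite run eqxx. Qed.

Lemma x_out k i : i != j k -> submxrow (x k.+1) i = submxrow (x k) i.
Proof. by move=> ij; rewrite run (negbTE ij). Qed.

(** Blockwise, [prox_point_residual] compares the step [1 / L] and current gradient with the step
    [gamma k] and delayed gradient; the window bounds the gradient error, and the square of a sum is
    at most twice the sum of squares. *)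
Lemma prox_grad_map_le k :
  enorm (prox_grad_map L f (separable r) (x k)) ^+ 2 <=
  \sum_i residual_bound x j k i.
Proof.
rewrite enorm_sqr_blocks; apply: ler_sum => i _.
rewrite /prox_grad_map submxrowZ submxrowB prox_separable//; last 2 first.
- by rewrite invr_gt0.
- exact: r_proper.
rewrite enormZ gtr0_norm// submxrowB submxrowZ -/(block_grad f i (x k)).
set q := prox _ _.
have L0' : 0 < L^-1 by rewrite invr_gt0.
have hq := block_prox_point (submxrow (x k) i - L^-1 *: block_grad f i (x k)) L0'.
have hq' := block_prox_point (submxrow (x k) i - L^-1 *: block_grad f i (x (k - tau k)%N)) L0'.
have gl : 0 < gamma k <= L^-1 by rewrite gamma_gt0 -[leRHS]mulr1 ler_pdivlMl// gamma_le1.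
have := prox_point_residual gl (ex_intro _ _ hq') (step_prox_point x k i) hq.
rewrite -/q invrK => hN.
have hw := block_grad_window i x_out (leq_subr (tau k) k).
have hc := @weighted_cauchy_schwarz _ _ (increment x j) (window_steps_past k).
have e0 : 0 <= \sum_(k - tau k <= t < k) increment x j t.
  by apply: sumr_ge0 => t _; exact: enorm_ge0.
rewrite /residual_bound; move: hN hw hc e0.
set A := _ / gamma k; set B := enorm (block_grad _ _ _ - _).
have <- : A = (gamma k)^-1 * enorm (step x k i - submxrow (x k) i) by rewrite /A mulrC.
set N := L * enorm _; set S := \sum_(_ <= t < _) increment x j t; set W := \sum_(_ <= t < _) _.
move=> hN hw hc S0.
have N0 : 0 <= N by rewrite mulr_ge0 ?enorm_ge0// ltW.
have A0 : 0 <= A by rewrite divr_ge0 ?enorm_ge0// ltW.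
have h1 : N ^+ 2 <= (A + L * S) ^+ 2.
  have AS : N <= A + L * S by lra.
  by rewrite ler_pXn2r ?nnegrE// (le_trans N0).
apply: le_trans h1 _.
have := ler_wpM2l (ltW L_gt0) hc; have := sqr_ge0 (A - L * S).
lra.
Qed.

(* Until block [i] is first updated, [x] may sit outside the domain of [r i];
   [z] replaces such blocks by those of the minimizer [xs]. *)
Definition z k : V :=
  \mxrow_i (if drawn j k i then submxrow (x k) i else submxrow xs i).

Lemma zE k i : submxrow (z k) i = if drawn j k i then submxrow (x k) i else submxrow xs i.
Proof. exact: mxrowK. Qed.

Lemma z0 : z 0 = xs.
Proof. by apply/mxrowP => i; rewrite zE; case: ifP => // /existsP[[]]. Qed.

Lemma z_in k : submxrow (z k.+1) (j k) = step x k (j k).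
Proof. by rewrite zE drawnS eqxx orbT x_in. Qed.

Lemma z_out k i : i != j k -> submxrow (z k.+1) i = submxrow (z k) i.
Proof. by move=> ij; rewrite !zE drawnS eq_sym (negbTE ij) orbF x_out. Qed.

Lemma x_undrawn k i : ~~ drawn j k i -> submxrow (x k) i = submxrow (x 0) i.
Proof.
elim: k => // k IH; rewrite drawnS negb_or => /andP[/IH <- jk].
by rewrite x_out// eq_sym.
Qed.

Definition gap (x0 : V) : R := \sum_i enorm (submxrow xs i - submxrow x0 i).

Lemma gap_ge0 x0 : 0 <= gap x0.
Proof. by apply: sumr_ge0 => i _; exact: enorm_ge0. Qed.

Local Notation D := (gap (x 0)).
Local Notation U k := ((pending j k)%:R : R).

(** [z] and [x] differ only on blocks not yet drawn, where they still hold [xs] and the initial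
    point. *)
Lemma zx_dist k : \sum_i enorm (submxrow (z k) i - submxrow (x k) i) <= D * U k.
Proof.
rewrite /pending; case: forallP => /= dk.
  rewrite mulr0 big1// => i _; by rewrite zE dk subrr enorm0.
rewrite mulr1; apply: ler_sum => i _; rewrite zE; case: ifPn => [_|/x_undrawn ->//].
by rewrite subrr enorm0 enorm_ge0.
Qed.

Lemma zx_dist_block k i : enorm (submxrow (z k) i - submxrow (x k) i) <= D * U k.
Proof.
apply: le_trans (zx_dist k); rewrite (bigD1 i)//= lerDl.
by apply: sumr_ge0 => l _; exact: enorm_ge0.
Qed.

Lemma pending_lag k : U k <= U (k - tau k)%N.
Proof.
by rewrite ler_nat; have := @pending_anti j _ _ (leq_subr (tau k) k);
  case: (pending j k) => [->|].
Qed.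

(** The comparison passes through [z] at the read time: the window accounts for the motion of [z],
    and the distance from [z] to [x] at that time for the rest. *)
Lemma block_grad_delay k i :
  enorm (block_grad f i (z k) - block_grad f i (x (k - tau k)%N)) <=
  L * \sum_(k - tau k <= t < k) increment z j t + L * (D * U (k - tau k)%N).
Proof.
rewrite -(subrKA (block_grad f i (z (k - tau k)%N))).
apply: le_trans (enormD _ _) _; apply: lerD.
  exact: (block_grad_window i z_out (leq_subr _ _)).
apply: le_trans (block_grad_lipschitz smooth _ _ _) _.
by rewrite ler_pM2l// zx_dist.
Qed.

(** The minimizer has finite block values, and every later change installs a prox point, where [r]
    is finite. *)
Lemma z_fin k i : r i (submxrow (z k) i) \is a fin_num.
Proof.
elim: k => [|k IH].
  rewrite z0; have [rho hrho _] := separable_fin r_ninfty (esym (fineK xs_fin)).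
  by rewrite hrho.
have [->|ij] := eqVneq i (j k); last by rewrite z_out.
by rewrite z_in; have [rho -> _] := step_prox_point x k (j k).
Qed.

Definition rz k i : R := fine (r i (submxrow (z k) i)).
Definition potential k : R := f (z k) + \sum_i rz k i.

Lemma potential_min k : potential 0 <= potential k.
Proof.
have e l : separable r (z l) = (\sum_i rz l i)%:E.
  by apply: separable_sum => i; rewrite fineK ?z_fin.
by have := xs_min (z k); rewrite -z0 !e -!EFinD lee_fin.
Qed.

Local Notation w t := (increment z j t ^+ 2 / gamma t).
Local Notation eps := ((1 - h) / 2).

(** Block descent for [f] and the prox inequality for [r], tested at the old block of [z], are
    added; Young's inequality splits the delayed gradient error into window terms and terms charged
    to pending blocks. *)
Lemma potential_step k : potential k.+1 - potential k <=
  L / 2 * (\sum_(k - tau k <= t < k.+1) gamma t) * w k +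
  L / 2 * (gamma k * \sum_(k - tau k <= t < k) w t) -
  (1 - eps) * w k + D ^+ 2 / eps * (U (k - tau k)%N / gamma k).
Proof.
have g0 := gamma_gt0 k; have /andP[h0 h1] := h01; have D0 := gap_ge0 (x 0).
set J := j k; set G := block_grad f J (x (k - tau k)%N).
pose Del := submxrow (z k.+1) J - submxrow (z k) J.
have incE : increment z j k = enorm Del by [].
have potE : potential k.+1 - potential k =
    f (z k + block_inj Del) - f (z k) + (rz k.+1 J - rz k J).
  have rE : \sum_i rz k.+1 i - \sum_i rz k i = rz k.+1 J - rz k J.
    rewrite -sumrB (bigD1 J)//= big1 ?addr0// => i iJ.
    by rewrite /rz z_out// subrr.
  rewrite -rE {1}/potential {1}(block_update (@z_out k)) -/J -/Del /potential; lra.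
have fstep := block_descent smooth (z k) Del.
(* The prox step starts from [x k] while the decrease is measured from [z k]; the offset [E] can be
   nonzero only while a block is pending. *)
have rstep : gamma k * (rz k.+1 J - rz k J) <=
    D * U (k - tau k)%N * enorm Del - gamma k * dot G Del - enorm Del ^+ 2.
  have [rho e /(_ (submxrow (z k) J) (rz k J))] := step_prox_point x k J.
  rewrite fineK ?z_fin// => /(_ erefl).
  have -> : rz k.+1 J = rho by rewrite /rz z_in e.
  rewrite -/G -z_in -/J.
  have -> : submxrow (x k) J - gamma k *: G - submxrow (z k.+1) J =
     - (submxrow (z k) J - submxrow (x k) J) - gamma k *: G - Del.
    by apply/rowP => l; rewrite !mxE; ring.
  have -> : submxrow (z k) J - submxrow (z k.+1) J = - Del by rewrite opprB.
  set E := submxrow (z k) J - submxrow (x k) J.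
  have : - dot E Del <= D * U (k - tau k)%N * enorm Del.
    rewrite -dotNl; apply: le_trans (dot_le_enorm _ _) _.
    rewrite enormN ler_wpM2r ?enorm_ge0//; apply: le_trans (zx_dist_block k J) _.
    by rewrite ler_wpM2l// pending_lag.
  by clearbody E Del; rewrite !dotE -enorm_sqr; lra.
have gstep : dot (block_grad f J (z k)) Del - dot G Del <=
   (L * \sum_(k - tau k <= t < k) increment z j t + L * (D * U (k - tau k)%N)) * enorm Del.
  rewrite -dotNl -dotDl; apply: le_trans (dot_le_enorm _ _) _.
  by rewrite ler_wpM2r ?enorm_ge0// block_grad_delay.
(* For each [t] in the window, [2 u v <= gamma t (u^2 / gamma k) + gamma k (v^2 / gamma t)]. *)
have young : L * (\sum_(k - tau k <= t < k) increment z j t) * enorm Del <=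
   L / 2 * ((\sum_(k - tau k <= t < k) gamma t) * w k + gamma k * \sum_(k - tau k <= t < k) w t).
  rewrite -mulrA -mulrA ler_pM2l// mulrC big_distrr big_distrl [in leRHS]big_distrr -big_split /=.
  rewrite big_distrr /=; apply: ler_sum => t _; rewrite -incE.
  have gt0 := gamma_gt0 t; set u := increment z j k; set v := increment z j t.
  have := mulr_ge0 (mulr_ge0 (ltW g0) (ltW gt0)) (sqr_ge0 (u / gamma k - v / gamma t)).
  have -> : gamma k * gamma t * (u / gamma k - v / gamma t) ^+ 2 =
    gamma t * (u ^+ 2 / gamma k) + gamma k * (v ^+ 2 / gamma t) - 2 * (u * v).
    by field; rewrite !gt_eqF.
  lra.
(* [L * gamma k <= 1] merges the two offset errors into one, which Young with weight [eps] splits;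
   the indicator equals its own square. *)
have lastterm : (L * (D * U (k - tau k)%N)) * enorm Del +
    D * U (k - tau k)%N * enorm Del / gamma k <=
    eps * w k + D ^+ 2 / eps * (U (k - tau k)%N / gamma k).
  have eps0 : 0 < eps by lra.
  set u := enorm Del; rewrite incE -/u; set b := U (k - tau k)%N.
  have bb : b ^+ 2 = b by rewrite /b; case: (pending _ _); rewrite ?expr1n ?expr0n.
  have b0 : 0 <= b by rewrite ler0n.
  have t1 : L * (D * b) * u <= D * b * u / gamma k.
    rewrite ler_pdivlMr//.
    have := ler_wpM2r (mulr_ge0 (mulr_ge0 D0 b0) (enorm_ge0 Del)) (gamma_le1 k).
    rewrite -/u; lra.
  have : 0 <= (eps * u - D * b) ^+ 2 / (eps * gamma k).
    by rewrite mulr_ge0 ?sqr_ge0// invr_ge0 ltW// mulr_gt0.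
  have -> : (eps * u - D * b) ^+ 2 / (eps * gamma k) =
    eps * (u ^+ 2 / gamma k) + D ^+ 2 / eps * (b ^+ 2 / gamma k) - 2 * (D * b * u / gamma k).
    by field; rewrite !gt_eqF//; lra.
  rewrite bb; lra.
have rstep' : rz k.+1 J - rz k J <= D * U (k - tau k)%N * enorm Del / gamma k -
    dot G Del - enorm Del ^+ 2 / gamma k.
  rewrite -(ler_pM2l g0); apply: le_trans rstep _.
  rewrite le_eqVlt; apply/orP; left; apply/eqP; field; by rewrite gt_eqF.
have half : L / 2 * enorm Del ^+ 2 = L / 2 * gamma k * w k.
  by rewrite incE; field; rewrite gt_eqF.
rewrite potE big_nat_recr ?leq_subr//=.
rewrite -incE in rstep' half fstep *; move: fstep rstep' gstep young lastterm half.
rewrite -incE; lra.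
Qed.

(** The potential starts at its minimum, so its telescoped changes sum to at least zero. The two
    window terms cost [h / 2] each, and [1 - eps - h = eps] is the coefficient left for the
    increments. *)
Lemma sum_z_increments K : \sum_(0 <= k < K) w k <=
  (D / eps) ^+ 2 * \sum_(0 <= k < K) U (k - tau k)%N / gamma k.
Proof.
have /andP[h0 h1] := h01; have eps0 : 0 < eps by lra.
have w0 t : 0 <= w t by rewrite divr_ge0 ?sqr_ge0// ltW.
have tel : potential K - potential 0 = \sum_(0 <= k < K) (potential k.+1 - potential k).
  by rewrite telescope_sumr.
have := potential_min K; rewrite -subr_ge0 tel =>
  /le_trans/(_ (ler_sum_nat (fun k _ => potential_step k))).
rewrite big_split big_split big_split /= sumrN.
rewrite -!big_distrr /=.
have s1 : \sum_(0 <= k < K) L / 2 * (\sum_(k - tau k <= t < k.+1) gamma t) * w k <=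
  h / 2 * \sum_(0 <= k < K) w k.
  rewrite big_distrr /=; apply: ler_sum => k _; rewrite ler_wpM2r//.
  by have := window_steps k; lra.
have s2 := window_exchange K w0.
set W := \sum_(0 <= k < K) w k in s1 s2 *; set UU := \sum_(0 <= k < K) U _ / _.
move=> tot.
have : eps * W <= D ^+ 2 / eps * UU by lra.
rewrite -ler_pdivlMl// => /le_trans; apply.
by rewrite le_eqVlt; apply/orP; left; apply/eqP; field; rewrite gt_eqF//; lra.
Qed.

(** The parenthesis bounds the increments of [x] through those of [z] and the offset; the factor 4
    dominates [2 + 2 * h ^+ 2]. *)
Definition residual_const (x0 : V) : R := 4 * (2 * (gap x0 / eps) ^+ 2 + 2 * gap x0 ^+ 2).

Lemma sum_residual_bound K :
  \sum_(0 <= k < K) gamma k * residual_bound x j k (j k) <=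
  residual_const (x 0) * \sum_(0 <= k < K) U (k - tau k)%N / gamma k.
Proof.
have /andP[h0 h1] := h01; have D0 := gap_ge0 (x 0).
pose v t := increment x j t ^+ 2 / gamma t.
have v0 t : 0 <= v t by rewrite divr_ge0 ?sqr_ge0// ltW.
have vle k : v k <= 2 * w k + 2 * D ^+ 2 * (U (k - tau k)%N / gamma k).
  rewrite /v ler_pdivrMr//.
  have -> : (2 * w k + 2 * D ^+ 2 * (U (k - tau k)%N / gamma k)) * gamma k =
     2 * increment z j k ^+ 2 + 2 * D ^+ 2 * U (k - tau k)%N.
    by field; rewrite gt_eqF.
  have bb : U (k - tau k)%N ^+ 2 = U (k - tau k)%N.
    by case: (pending _ _); rewrite ?expr1n ?expr0n.
  (* The drawn block ends at the same point in [x] and [z], so the increments differ only by the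
     offset at its starting point. *)
  have : increment x j k <= increment z j k + D * U (k - tau k)%N.
    rewrite /increment z_in x_in -(subrKA (submxrow (z k) (j k))).
    apply: le_trans (enormD _ _) _; rewrite lerD2l.
    by apply: le_trans (zx_dist_block k _) _; rewrite ler_wpM2l// pending_lag.
  have := enorm_ge0 (submxrow (x k.+1) (j k) - submxrow (x k) (j k)).
  rewrite -/(increment x j k) -{2}bb; set a := increment x j k; set b := increment z j k.
  set e := D * _ => a0 ab.
  have : a ^+ 2 <= (b + e) ^+ 2 by rewrite ler_pXn2r// ?nnegrE//; lra.
  have := sqr_ge0 (b - e); rewrite -mulrA -exprMn -/e; lra.
have sv : \sum_(0 <= k < K) v k <= 4^-1 * residual_const (x 0) *
    \sum_(0 <= k < K) U (k - tau k)%N / gamma k.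
  apply: le_trans (ler_sum_nat (fun k _ => vle k)) _.
  rewrite big_split /= -!big_distrr /=; have := sum_z_increments K.
  rewrite /residual_const; lra.
apply: (@le_trans _ _ (4 * \sum_(0 <= k < K) v k)); last by lra.
(* At the drawn block the virtual displacement is the actual increment. *)
have e k : gamma k * residual_bound x j k (j k) =
   2 * v k + 2 * h * (L * (gamma k * \sum_(k - tau k <= t < k) v t)).
  rewrite /residual_bound -x_in -/(increment x j k) /v.
  by field; rewrite gt_eqF.
rewrite (eq_bigr _ (fun k _ => e k)) big_split /= -!big_distrr /=.
have := window_exchange K v0; have : 0 <= \sum_(0 <= k < K) v k by exact: sumr_ge0.
set W := \sum_(0 <= k < K) v k => W0 /(ler_wpM2l (ltW h0)).
have hW : h * W <= W by rewrite ler_piMl// ltW.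
have : h * (h * W) <= h * W by rewrite ler_pM2l.
lra.
Qed.

End Trajectory.
End Pathwise.

(** * Expectations of functions of finite-valued variables *)

Section FiniteValued.
Variables (R : realType) (dd : measure_display) (Omega : measurableType dd)
  (Pr : probability Omega R).

Section OneVariable.
Variables (T : finType) (X : Omega -> T).
Hypothesis mX : forall s, measurable (X @^-1` [set s]).

Lemma finite_measurable_preimage (B : set T) : measurable (X @^-1` B).
Proof.
rewrite (_ : X @^-1` B = \bigcup_(s in B) (X @^-1` [set s])).
  by apply: fin_bigcup_measurable => // s _.
by apply/seteqP; split=> w /= => [Bw|[s Bs ->]//]; exists (X w).
Qed.

Lemma finite_measurable_fun (F : T -> R) : measurable_fun setT (fun w => F (X w)).
Proof.
move=> _ Y _; rewrite setTI.
exact: (finite_measurable_preimage (F @^-1` Y)).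
Qed.

Lemma finite_integral (F : T -> R) : (forall s, 0 <= F s) ->
  (\int[Pr]_w (F (X w))%:E = \sum_s (F s)%:E * Pr (X @^-1` [set s]))%E.
Proof.
move=> F0.
have mI s : measurable_fun setT (EFin \o (\1_(X @^-1` [set s]) : Omega -> R)).
  by apply/measurable_EFinP; exact: measurable_indic.
under eq_integral => w _.
  rewrite (_ : (F (X w))%:E = \sum_s ((F s)%:E * (\1_(X @^-1` [set s]) w)%:E)%E); last first.
    rewrite (bigD1 (X w))//= big1 ?adde0 => [|s sX].
      by rewrite indicE mem_set ?mule1.
    by rewrite indicE memNset ?mule0//= => e; move: sX; rewrite e eqxx.
  over.
rewrite ge0_integral_sum//.
- apply: eq_bigr => s _; rewrite ge0_integralZl_EFin//.
    by rewrite integral_indic// setIT.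
  exact: mI.
- by move=> s; apply: (measurable_funeM _ (mI s)).
- by move=> s w _; rewrite mule_ge0// lee_fin.
Qed.

End OneVariable.
Lemma integral_weighted_sum (c : nat -> R) (Z : nat -> Omega -> R) (K : nat) :
  (forall t, 0 <= c t) -> (forall t w, 0 <= Z t w) ->
  (forall t, measurable_fun setT (fun w => (Z t w)%:E)) ->
  (\int[Pr]_w (\sum_(0 <= t < K) c t * Z t w)%:E =
   \sum_(0 <= t < K) (c t)%:E * \int[Pr]_w (Z t w)%:E)%E.
Proof.
move=> c0 Z0 mZ; under eq_integral do rewrite -sumEFin.
rewrite ge0_integral_sum//.
- apply: eq_bigr => t _; under eq_integral do rewrite EFinM.
  by rewrite ge0_integralZl_EFin// => w _; rewrite lee_fin.
- by move=> t; under eq_fun do rewrite EFinM; apply: measurable_funeM.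
- by move=> t w _; rewrite lee_fin mulr_ge0.
Qed.

End FiniteValued.

(** * Independent uniform block draws *)

Section Draws.
Variables (R : realType) (dd : measure_display) (Omega : measurableType dd)
  (Pr : probability Omega R) (m : nat) (J : nat -> Omega -> 'I_m).
Hypothesis iidJ : iid_uniform Pr J.

Lemma draws_nonempty : (0 < m)%N.
Proof.
have [w _] : [set: Omega] !=set0.
  apply/set0P/negP => /eqP T0; have := probability_setT Pr.
  by rewrite T0 measure0 => -[/esym/eqP]; rewrite oner_eq0.
exact: leq_ltn_trans (leq0n _) (ltn_ord (J 0 w)).
Qed.

Lemma measurable_draw k (B : set 'I_m) : measurable (J k @^-1` B).
Proof. by have [mJ _ _] := iidJ; exact: finite_measurable_preimage. Qed.

Lemma draws_prob n (B : nat -> set 'I_m) (q : R) :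
  (forall k, Pr (J k @^-1` B k) = q%:E) ->
  Pr (\bigcap_(k in [set` iota 0 n]) (J k @^-1` B k)) = (q ^+ n)%:E.
Proof.
have [_ _ ind] := iidJ => Bq; rewrite ind ?iota_uniq//; last first.
  by move=> k; exact: measurable_draw.
rewrite (eq_bigr _ (fun k _ => Bq k)) prodEFin; congr EFin.
rewrite big_const_seq count_predT size_iota.
by elim: n => //= n ->; rewrite exprS.
Qed.

Lemma set_iota n : [set` iota 0 n] = [set k | (k < n)%N].
Proof. by apply/seteqP; split=> k /=; rewrite mem_iota add0n. Qed.

(** Recording the past in a finite type reduces expectations to finite sums over cylinders. *)
Definition history n (w : Omega) : {ffun 'I_n -> 'I_m} := [ffun t : 'I_n => J t w].

(** [insub] succeeds exactly for [k < n], which selects the prescribed past; at [k = n] the default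
    [i] prescribes the new draw. *)
Lemma history_draw_cyl n (s : {ffun 'I_n -> 'I_m}) i :
  (fun w => (history n w, J n w)) @^-1` [set (s, i)] =
  \bigcap_(k in [set` iota 0 n.+1]) (J k @^-1` [set if insub k is Some t then s t else i]).
Proof.
rewrite set_iota; apply/seteqP; split=> w /=.
  move=> [<- <-] k /=; rewrite ltnS => kn.
  case: insubP => [t _ <-|]; first by rewrite ffunE.
  by rewrite -leqNgt => nk; congr (J _ w); apply/eqP; rewrite eqn_leq kn nk.
move=> H; congr pair.
  apply/ffunP => t; rewrite ffunE.
  have /= -> := H t (ltnW (ltn_ord t)).
  by case: insubP => [u _ /val_inj ->//|]; rewrite ltn_ord.
have /= -> := H n (ltnSn n).
by case: insubP => // u; rewrite ltnn.
Qed.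

Lemma history_cyl n (s : {ffun 'I_n -> 'I_m}) (i : 'I_m) :
  history n @^-1` [set s] =
  \bigcap_(k in [set` iota 0 n]) (J k @^-1` [set if insub k is Some t then s t else i]).
Proof.
rewrite set_iota; apply/seteqP; split=> w /=.
  move=> <- k /= kn.
  by case: insubP => [t _ <-|]; [rewrite ffunE|rewrite kn].
move=> H; apply/ffunP => t; rewrite ffunE.
have /= -> := H t (ltn_ord t).
by case: insubP => [u _ /val_inj ->//|]; rewrite ltn_ord.
Qed.

Lemma measurable_history n s : measurable (history n @^-1` [set s]).
Proof.
rewrite (history_cyl s (Ordinal draws_nonempty)).
by apply: bigcap_measurableType => k _; exact: measurable_draw.
Qed.

Lemma measurable_history_draw n (p : {ffun 'I_n -> 'I_m} * 'I_m) :
  measurable ((fun w => (history n w, J n w)) @^-1` [set p]).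
Proof.
case: p => s i; rewrite history_draw_cyl.
by apply: bigcap_measurableType => k _; exact: measurable_draw.
Qed.

(** Plays the part of measurability with respect to the first [n] draws, expressed pointwise as
    dependence on them alone. *)
Definition adapted (T : Type) n (X : Omega -> T) := forall w w',
  (forall k, (k < n)%N -> J k w = J k w') -> X w = X w'.

Lemma adapted_history n (X : Omega -> R) : adapted n X -> (forall w, 0 <= X w) ->
  exists2 F : {ffun 'I_n -> 'I_m} -> R, (forall s, 0 <= F s) &
    forall w, X w = F (history n w).
Proof.
move=> aX X0.
(* Histories that no sample point realizes get the default 0, which keeps [F] nonnegative; elsewhere
   any realizing sample point gives the same value. *)
pose F s := if pselect (exists w, history n w = s) is left e then X (sval (cid e)) else 0.
exists F => [s|w]; rewrite /F; case: pselect => // [e|[]]; last by exists w.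
case: cid => w' /= e'; apply: aX => k kn.
by move/ffunP/(_ (Ordinal kn)): e'; rewrite !ffunE.
Qed.

Lemma adapted_measurable n (X : Omega -> R) : adapted n X -> (forall w, 0 <= X w) ->
  measurable_fun setT (fun w => (X w)%:E).
Proof.
move=> aX X0; have [F _ XF] := adapted_history aX X0.
apply/measurable_EFinP.
rewrite (funext XF).
exact: (finite_measurable_fun (@measurable_history n)).
Qed.

(** Both expectations become sums over cylinders: a past of length [n] has probability [m^-n], and
    adding the next draw multiplies it by [m^-1]. This recovers all blocks from the single drawn
    one. *)
Lemma integral_adapted_draw n (X : 'I_m -> Omega -> R) :
  (forall i, adapted n (X i)) -> (forall i w, 0 <= X i w) ->
  (\sum_i \int[Pr]_w (X i w)%:E = m%:R%:E * \int[Pr]_w (X (J n w) w)%:E)%E.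
Proof.
move=> aX X0; have [_ unif _] := iidJ; have m0 := draws_nonempty.
have /choice[F FP] : forall i, exists F : {ffun 'I_n -> 'I_m} -> R,
    (forall s, 0 <= F s) /\ forall w, X i w = F (history n w).
  by move=> i; have [F F0 FX] := adapted_history (aX i) (X0 i); exists F.
have -> : (\int[Pr]_w (X (J n w) w)%:E =
    \sum_(p : {ffun 'I_n -> 'I_m} * 'I_m) (F p.2 p.1 * m%:R^-1 ^+ n.+1)%:E)%E.
  have E := @finite_integral R dd Omega Pr _ _ (@measurable_history_draw n)
    (fun p => F p.2 p.1) (fun p => proj1 (FP _) _).
  transitivity (\int[Pr]_w (F (J n w) (history n w))%:E)%E.
    by apply: eq_integral => w _ /=; rewrite (proj2 (FP _)).
  apply: etrans E _.
  apply: eq_bigr => -[s i] _; rewrite EFinM; congr (_ * _)%E.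
  by rewrite history_draw_cyl; apply: draws_prob => k; exact: unif.
have -> : (\sum_i \int[Pr]_w (X i w)%:E =
    \sum_i \sum_(s : {ffun 'I_n -> 'I_m}) (F i s * m%:R^-1 ^+ n)%:E)%E.
  apply: eq_bigr => i _.
  rewrite (eq_integral (fun w => (F i (history n w))%:E)); last first.
    by move=> w _; rewrite (proj2 (FP i)).
  rewrite (finite_integral Pr (@measurable_history n) (proj1 (FP i))).
  apply: eq_bigr => s _; rewrite EFinM; congr (_ * _)%E.
  by rewrite (history_cyl s i); apply: draws_prob => k; exact: unif.
rewrite exchange_big pair_big /= !sumEFin -EFinM; congr EFin.
rewrite big_distrr /=; apply: eq_bigr => p _.
by rewrite exprS mulrCA mulVKf// pnatr_eq0 -lt0n.
Qed.

(** Union bound over the blocks: a fixed block escapes [n] independent draws with probability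
    [(1 - 1 / m)^n]. *)
Lemma pending_expectation n :
  (\int[Pr]_w ((pending (fun k => J k w) n)%:R : R)%:E <=
   (m%:R * (1 - m%:R^-1) ^+ n)%:E)%E.
Proof.
have [_ unif _] := iidJ.
pose A i := \bigcap_(k in [set` iota 0 n]) (J k @^-1` (~` [set i])).
have mA i : measurable (A i).
  by apply: bigcap_measurableType => k _; exact: measurable_draw.
have PA i : Pr (A i) = ((1 - m%:R^-1) ^+ n)%:E.
  apply: draws_prob => k; rewrite -preimage_setC probability_setC ?unif//.
  exact: measurable_draw.
have mI i : measurable_fun setT (EFin \o (\1_(A i) : Omega -> R)).
  by apply/measurable_EFinP; exact: measurable_indic.
have -> : (m%:R * (1 - m%:R^-1) ^+ n)%:E = (\int[Pr]_w \sum_i (\1_(A i) w)%:E)%E.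
  rewrite ge0_integral_sum//.
  rewrite (eq_bigr (fun=> ((1 - m%:R^-1) ^+ n)%:E)) => [|i _]; last first.
    by rewrite integral_indic// setIT; exact: PA.
  by rewrite sumEFin sumr_const card_ord mulr_natl.
apply: ge0_le_integral => //.
- apply: (@adapted_measurable n); last by move=> w; exact: ler0n.
  move=> w w' e; rewrite /pending; congr ((~~ _)%:R).
  apply: eq_forallb => i; apply: eq_existsb => t; by rewrite e.
- by apply: emeasurable_sum.
move=> w _; rewrite sumEFin lee_fin /pending negb_forall.
case: existsP => [[i]|_]; last by apply: sumr_ge0.
rewrite negb_exists => /forallP ni.
rewrite (bigD1 i)//= indicE mem_set ?lerDl ?sumr_ge0//.
rewrite /A set_iota => k /= kn; apply/eqP.
exact: (ni (Ordinal kn)).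
Qed.

End Draws.

(** Strong induction, since update [k] also reads the iterate at [k - tau k]. This makes the
    iterates functions of the past draws. *)
Lemma run_determined (R : realType) (m : nat) (d : 'I_m -> nat)
  (f : 'rV[R]_(\sum_i d i) -> R) (r : forall i : 'I_m, 'rV[R]_(d i) -> \bar R)
  (gamma : nat -> R) (tau : nat -> nat) (j j' : nat -> 'I_m)
  (x x' : nat -> 'rV[R]_(\sum_i d i)) (n : nat) :
  async_bcd f r gamma tau j x -> async_bcd f r gamma tau j' x' -> x 0%N = x' 0%N ->
  (forall k, (k < n)%N -> j k = j' k) -> forall k, (k <= n)%N -> x k = x' k.
Proof.
move=> run run' x0 jj'; elim/ltn_ind => -[//|k] IH kn.
have xk l : (l <= k)%N -> x l = x' l by move=> lk; apply: IH => //; exact: leq_trans (ltnW kn).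
by apply/mxrowP => i; rewrite run run' jj'// !xk// leq_subr.
Qed.

(** * Assembly of the convergence rate *)

Unset Implicit Arguments.
Set Strict Implicit.
Set Printing Implicit Defensive.

Theorem theorem2 (R : realType) (m : nat) (d : 'I_m -> nat) (L : R)
  (f : 'rV[R]_(\sum_i d i) -> R)
  (r : forall i : 'I_m, 'rV[R]_(d i) -> \bar R)
  (Pstar : \bar R) (a b c h : R)
  (tau : nat -> nat) (gamma : nat -> R)
  (dd : measure_display) (Omega : measurableType dd)
  (Pr : probability Omega R) (J : nat -> Omega -> 'I_m)
  (x0 : 'rV[R]_(\sum_i d i))
  (x : nat -> Omega -> 'rV[R]_(\sum_i d i)) :
  0 < L ->
  block_smooth L f ->
  (forall i y, r i y != -oo%E) ->
  (forall i, convex_efun (r i)) ->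
  (forall i, closed_efun (r i)) ->
  is_minimum (fun y => (f y)%:E + separable r y)%E Pstar ->
  Pstar \is a fin_num ->
  0 < a < 1 -> 0 <= b <= 1 -> 0 <= c ->
  (forall k : nat, (tau k <= k)%N /\ (tau k)%:R <= a * k%:R `^ b + c) ->
  0 < h < 1 ->
  (forall k : nat,
     gamma k = h / (L * (a * ((k%:R + c) / (1 - a)) `^ b + c + 1))) ->
  iid_uniform Pr J ->
  (forall w, x 0%N w = x0) ->
  (forall w, async_bcd f r gamma tau (fun k => J k w) (fun k => x k w)) ->
  ebigO
    (fun k => \big[Order.min/+oo%E]_(t < k.+1)
       'E_Pr[fun w => (enorm (prox_grad_map L f (separable r) (x t w)) ^+ 2)%R]%E)
    (fun k => (rate b k)^-1).
Proof.
move=> L0 smooth rN cvx cl [[xs xsP] Pmin] Pfin a01 b01 c0 tau_le h01 gammaE iidJ xinit run.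
have /andP[h0 h1] := h01.
have g0 := gamma_gt0 L0 a01 c0 h01 gammaE.
have g1 := gamma_le1 L0 a01 c0 h01 gammaE.
have ws := window_steps L0 a01 b01 c0 tau_le h01 gammaE.
have we := window_exchange L0 a01 b01 c0 tau_le h01 gammaE.
have xs_fin : separable r xs \is a fin_num.
  by move: Pfin; rewrite -xsP fin_numD => /andP[].
have xs_min y : ((f xs)%:E + separable r xs <= (f y)%:E + separable r y)%E.
  by rewrite xsP Pmin.
pose N t w : R := enorm (prox_grad_map L f (separable r) (x t w)) ^+ 2.
pose X t i w := residual_bound L h f r tau gamma (fun k => x k w) (fun k => J k w) t i.
have X0 t i w : 0 <= X t i w by exact: (residual_bound_ge0 _ _ _ L0 h01 g0).
have agree t w w' : (forall k, (k < t)%N -> J k w = J k w') ->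
    forall k, (k <= t)%N -> x k w = x k w'.
  by move=> e; apply: (run_determined (run w) (run w')); rewrite ?xinit.
have aN t : adapted J t (N t) by move=> w w' /agree e; rewrite /N e.
have aX t i : adapted J t (X t i).
  move=> w w' e; have ex := agree _ _ _ e.
  rewrite /X /residual_bound /step !ex ?leq_subr//; congr (_ + 2 * (L * h * _)).
  apply: eq_big_nat => k /andP[_ kt].
  by rewrite /increment !ex ?e// ltnW.
(* Unlike [X t i], [Y t] also depends on draw [t], hence on [t + 1] draws. *)
pose Y t w := X t (J t w) w.
have aY t : adapted J t.+1 (Y t).
  move=> w w' e; rewrite /Y (e t)//; apply: aX => k kt; apply: e; exact: ltnW.
have Y0 t w : 0 <= Y t w by exact: X0.
have mY t := adapted_measurable iidJ (aY t) (Y0 t).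
have N0 t w : 0 <= N t w by exact: sqr_ge0.
pose pd k w : R := (pending (fun t => J t w) (k - tau k))%:R.
have pd0 k w : 0 <= pd k w by exact: ler0n.
have apd k : adapted J (k - tau k) (pd k).
  move=> w w' e; rewrite /pd /pending; congr ((~~ _)%:R).
  by apply: eq_forallb => i; apply: eq_existsb => t; rewrite e.
have mpd k := adapted_measurable iidJ (apd k) (pd0 k).
have NY t : (\int[Pr]_w (N t w)%:E <= m%:R%:E * \int[Pr]_w (Y t w)%:E)%E.
  rewrite -(integral_adapted_draw iidJ (aX t) (X0 t)).
  rewrite -ge0_integral_sum//; last 2 first.
  - by move=> i; exact: (adapted_measurable iidJ (aX t i)).
  - by move=> i w _; rewrite lee_fin.
  apply: ge0_le_integral => //.
  - by move=> w _; rewrite lee_fin.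
  - exact: (adapted_measurable iidJ (aN t) (N0 t)).
  - by apply: emeasurable_sum => i; exact: (adapted_measurable iidJ (aX t i)).
  - move=> w _; rewrite sumEFin lee_fin.
    exact: (prox_grad_map_le L0 smooth rN cvx cl xs_fin h01 g0 g1 ws (run w)).
have m0 : (0 < m)%N by exact: (draws_nonempty Pr J).
have m1 : 0 < (m%:R^-1 : R) <= 1 by rewrite invr_gt0 ltr0n invf_le1 ?ltr0n ?ler1n m0.
have [C1 HC1] := sum_geometric_lag L0 a01 b01 c0 tau_le h01 gammaE m1.
pose C0 := residual_const h xs x0.
have C00 : 0 <= C0.
  by rewrite mulr_ge0// addr_ge0// mulr_ge0// sqr_ge0.
(* The outer [m] comes from averaging over the drawn block, [C0] from the pathwise bound, the inner
   [m] from the union bound and [C1] from the summed geometric decay. *)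
pose C := m%:R * (C0 * (m%:R * C1)).
have total K : (\sum_(0 <= t < K) (gamma t)%:E * \int[Pr]_w (N t w)%:E <= C%:E)%E.
  apply: (@le_trans _ _ (\sum_(0 <= t < K) m%:R%:E * ((gamma t)%:E * \int[Pr]_w (Y t w)%:E))%E).
    by apply: lee_sum => t _; rewrite muleCA lee_pmul2l ?lte_fin.
  rewrite -ge0_sume_distrr; last first.
    move=> t _; rewrite mule_ge0 ?lee_fin ?(ltW (g0 t))// integral_ge0// => w _.
    by rewrite lee_fin.
  rewrite -(integral_weighted_sum Pr K (fun t => ltW (g0 t)) Y0 mY).
  rewrite EFinM lee_pmul2l ?lte_fin ?ltr0n//.
  apply: (@le_trans _ _ (\int[Pr]_w (C0 * \sum_(0 <= k < K) (gamma k)^-1 * pd k w)%:E)%E).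
    apply: ge0_le_integral => //.
    - by move=> w _; rewrite lee_fin sumr_ge0// => t _; rewrite mulr_ge0// ltW.
    - apply: (@adapted_measurable _ _ _ _ _ _ iidJ K); last first.
        by move=> w; rewrite sumr_ge0// => t _; rewrite mulr_ge0// ltW.
      move=> w w' e; apply: eq_big_nat => t /andP[_ tK].
      congr (_ * _); apply: aY => k kt; apply: e; exact: leq_trans tK.
    - apply: (@adapted_measurable _ _ _ _ _ _ iidJ K); last first.
        move=> w; rewrite mulr_ge0// sumr_ge0// => t _.
        by rewrite mulr_ge0// invr_ge0 ltW.
      move=> w w' e; congr (_ * _); apply: eq_big_nat => t /andP[_ tK].
      congr (_ * _); apply: apd => k kt; apply: e.
      exact: leq_trans kt (leq_trans (leq_subr _ _) (ltnW tK)).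
    - move=> w _; rewrite lee_fin.
      have := sum_residual_bound L0 smooth rN cvx cl xs_fin xs_min h01 g0 g1 ws we (run w) K.
      rewrite xinit => /le_trans; apply; rewrite ler_wpM2l//.
      by apply: ler_sum => k _; rewrite mulrC.
  under eq_integral do rewrite EFinM.
  rewrite ge0_integralZl_EFin//; last 2 first.
  - by move=> w _; rewrite lee_fin sumr_ge0// => t _; rewrite mulr_ge0// invr_ge0 ltW.
  - apply: (@adapted_measurable _ _ _ _ _ _ iidJ K); last first.
      by move=> w; rewrite sumr_ge0// => t _; rewrite mulr_ge0// invr_ge0 ltW.
    move=> w w' e; apply: eq_big_nat => t /andP[_ tK].
    congr (_ * _); apply: apd => k kt; apply: e.
    exact: leq_trans kt (leq_trans (leq_subr _ _) (ltnW tK)).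
  rewrite [leRHS]EFinM lee_wpmul2l ?lee_fin//.
  have gV k : 0 <= (gamma k)^-1 by rewrite invr_ge0 ltW.
  rewrite (integral_weighted_sum Pr K gV pd0 mpd).
  apply: (@le_trans _ _ (\sum_(0 <= k < K)
      (m%:R * ((1 - m%:R^-1) ^+ (k - tau k) * (gamma k)^-1))%:E)%E).
    apply: lee_sum => k _; rewrite mulrA mulrC EFinM lee_wpmul2l ?lee_fin//.
    exact: (pending_expectation iidJ).
  by rewrite sumEFin lee_fin -big_distrr ler_wpM2l.
have /andP[a0 a1] := a01.
pose c1 := h / (L * growth a b c).
have c10 : 0 < c1.
  have := growth_ge1 b a01 c0 => G1.
  by rewrite divr_gt0// mulr_gt0//; lra.
(* Adding 1 to the absolute value makes the constant positive; [c1] is the factor between the rate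
   and the sum of steps. *)
exists ((`|C| + 1) / c1); first by rewrite divr_gt0// ltr_wpDl.
(* From [k = 2] on, [ln k] is positive, so the rate can be inverted also when [b = 1]. *)
exists 2%N => // k /= k2.
have rate0 : 0 < rate b k.
  rewrite /rate; case: ifP => _; first by rewrite powR_gt0// ltr0n ltnW.
  by rewrite ln_gt0// ltr1n.
have S := sum_gamma_ge L0 a01 b01 c0 h01 gammaE (ltnW k2 : (0 < k)%N).
set Mn := \big[Order.min/+oo%E]_(_ < _) _.
have Mn0 : (0 <= Mn)%E.
  apply/bigmin_geP; split=> // t _; rewrite unlock integral_ge0// => w _.
  by rewrite lee_fin sqr_ge0.
rewrite gee0_abs//.
have Mne (t : 'I_k.+1) : (Mn <= \int[Pr]_w (N t w)%:E)%E.
  by apply: (bigmin_inf t) => //; rewrite unlock.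
(* The minimum is below each term, so its product with the total step length is below the weighted
   sum. *)
have SM : ((\sum_(0 <= t < k.+1) gamma t)%:E * Mn <= C%:E)%E.
  apply: le_trans (total k.+1); rewrite -sumEFin ge0_sume_distrl; last first.
    by move=> t _; rewrite lee_fin ltW.
  rewrite !big_mkord; apply: lee_sum => t _.
  by rewrite lee_pmul2l// ?lte_fin.
have S0 : 0 < c1 * rate b k by rewrite mulr_gt0.
have {}SM : ((c1 * rate b k)%:E * Mn <= (`|C| + 1)%:E)%E.
  apply: (@le_trans _ _ C%:E); last by rewrite lee_fin ler_wpDr// ler_norm.
  by apply: le_trans SM; rewrite lee_wpmul2r// lee_fin.
rewrite [`|_^-1|]gtr0_norm ?invr_gt0//.
have -> : (`|C| + 1) / c1 * (rate b k)^-1 = (c1 * rate b k)^-1 * (`|C| + 1).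
  by clearbody c1; rewrite invfM [RHS]mulrC mulrA.
by rewrite EFinM lee_pdivlMl.
Qed.
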